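(* Let $\kappa_{\mathbb E}:\mathbb E\times\mathbb E\to\mathbb C$ be the Szegő kernel of the tetrablock $\mathbb E$. There exist a nonempty open subset $W$ of $\mathbb E$ and a constant $c>0$ such that for all $z=(z_1,z_2,z_3)$ and $w=(w_1,w_2,w_3)$ in $W$, $$\kappa_{\mathbb E}(z,w)=c\,\sum_{k=0}^\infty\binom{3/2}{2k+1}\frac{\big(1-\langle\sigma(z),w\rangle\big)^{\frac32-2k-1}\,4^k\,(z_1z_2-z_3)^k(\overline w_1\overline w_2-\overline w_3)^k}{\Big(\big(1-\langle\sigma(z),w\rangle\big)^2-4(z_1z_2-z_3)(\overline w_1\overline w_2-\overline w_3)\Big)^{\frac32}},$$ where $\sigma(z_1,z_2,z_3)=(z_1,z_2,-z_3)$, $\langle\cdot,\cdot\rangle$ is the standard inner product on $\mathbb C^3$, the series converges, and the numbers raised to fractional powers lie in $\mathbb C\setminus(-\infty,0]$ (principal branches being used).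
   Context: The tetrablock is $$\mathbb E=\{(z_1,z_2,z_3)\in\mathbb C^3: 1-z_1z-z_2w+z_3zw\neq 0\text{ for all } z,w\in\overline{\mathbb D}\},$$ where $\mathbb D$ is the open unit disc. The inner product is $\langle a,b\rangle=\sum_{j=1}^3 a_j\overline b_j$. The Cartan domain of type II in $\mathbb C^3$ is $$\mathfrak R_{II}=\left\{(z_1,z_2,z_3)\in\mathbb C^3:\left\|\begin{bmatrix} z_1 & z_3 \\ z_3 & z_2 \end{bmatrix}\right\|<1\right\}$$ (operator norm). Its Hardy space $H^2(\mathfrak R_{II})$ is the reproducing kernel Hilbert space of holomorphic functions on $\mathfrak R_{II}$ with reproducing kernel $$\kappa(z,w)=\frac{1}{\mathrm{Vol}(\mathfrak R_{II})}\det\left(I-\begin{bmatrix} z_1 & z_3 \\ z_3 & z_2 \end{bmatrix}\begin{bmatrix} \overline w_1 & \overline w_3 \\ \overline w_3 & \overline w_2 \end{bmatrix}\right)^{-3/2},$$ where the power is the continuous branch on $\mathfrak R_{II}\times\mathfrak R_{II}$ equal to $1$ at $w=0$. Let $\phi:\mathfrak R_{II}\to\mathbb E$ be the surjective map $\phi(z)=(z_1,z_2,z_1z_2-z_3^2)$, whose Jacobian determinant is $J_\phi(z)=-2z_3$. The Szegő kernel $\kappa_{\mathbb E}$ of the tetrablock is the reproducing kernel of the Hilbert space $$\{f:\mathbb E\to\mathbb C\text{ holomorphic}: J_\phi\cdot(f\circ\phi)\in H^2(\mathfrak R_{II})\}$$ with norm $\|f\|=\|J_\phi\cdot(f\circ\phi)\|_{H^2(\mathfrak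 R_{II})}$. *)

(* Defs.v *)
From HB Require Import structures.
From mathcomp Require Import all_boot all_order all_algebra.
From mathcomp Require Import complex.
From mathcomp Require Import all_classical all_reals all_analysis.

Set Implicit Arguments.
Unset Strict Implicit.
Unset Printing Implicit Defensive.

Import Order.TTheory GRing.Theory Num.Theory.
Import numFieldNormedType.Exports.

Local Open Scope classical_set_scope.
Local Open Scope complex_scope.
Local Open Scope ring_scope.

(* Naming the numClosedFieldType structure of R[i] is what makes the topology
   and the normed-module structure over itself inferable; the order of this
   structure satisfies  z <= w  iff  w - z is real and nonnegative. *)
Definition CC (R : realType) : numClosedFieldType := R[i].

Notation C3 R := 'rV[CC R]_3.

Definition vec3 (R : realType) (a b c : CC R) : C3 R :=
  \row_(j < 3) [:: a; b; c]`_j.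

Definition cexp (R : realType) (z : CC R) : CC R :=
  (expR (complex.Re z))%:C * (cos (complex.Im z) +i* sin (complex.Im z)).

(* The principal argument, in ]-pi, pi] for z != 0. *)
Definition carg (R : realType) (z : CC R) : R :=
  if 0 <= complex.Im z then acos (complex.Re z / Normc.normc z) else - acos (complex.Re z / Normc.normc z).

Definition clog (R : realType) (z : CC R) : CC R := ln (Normc.normc z) +i* carg z.

Definition cpow (R : realType) (z a : CC R) : CC R := cexp (a * clog z).

(* C \ ]-oo, 0]; recall that z <= 0 entails that z is real. *)
Definition slit_plane (R : realType) : set (CC R) := [set z | ~~ (z <= 0)].

Definition gbinom (R : realType) (a : CC R) (n : nat) : CC R :=
  (\prod_(i < n) (a - i%:R)) / n`!%:R.

Definition enorm (R : realType) (n : nat) (x : 'cV[CC R]_n) : R :=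
  Num.sqrt (\sum_(i < n) Normc.normc (x i 0) ^+ 2).

Definition opnorm (R : realType) (n : nat) (A : 'M[CC R]_n) : R :=
  sup [set enorm (A *m x) | x in [set x : 'cV[CC R]_n | enorm x <= 1]].

Definition symmx (R : realType) (z : C3 R) : 'M[CC R]_2 :=
  \matrix_(i < 2, j < 2)
    (nth [::] [:: [:: z 0 0; z 0 2%:R]; [:: z 0 2%:R; z 0 1]] i)`_j.

Definition tetrablock (R : realType) : set (C3 R) :=
  [set z | forall a b : CC R, `|a| <= 1 -> `|b| <= 1 ->
     1 - z 0 0 * a - z 0 1 * b + z 0 2%:R * a * b != 0].

Definition cartanII (R : realType) : set (C3 R) :=
  [set z | opnorm (symmx z) < 1].

(* The six-dimensional Lebesgue measure of cartanII in the real coordinates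
   (Re z_1, Im z_1, Re z_2, Im z_2, Re z_3, Im z_3). *)
Definition vol_cartanII (R : realType) : R :=
  let mu := @lebesgue_measure R in
  fine ((mu \x mu \x mu \x mu \x mu \x mu)%E
    [set p : R * R * R * R * R * R |
       let: (x1, y1, x2, y2, x3, y3) := p in
       cartanII (vec3 (x1 +i* y1) (x2 +i* y2) (x3 +i* y3))]).

(* Complex Fréchet differentiability at every point; only the restriction of f
   to U matters when U is open. *)
Definition holomorphic_on (R : realType) (U : set (C3 R)) (f : C3 R -> CC R) :=
  forall z, U z -> differentiable f z.

(* p is a continuous branch of the power d ^ a on X: it is exp (a * L) for some
   continuous logarithm L of d. *)
Definition continuous_power (R : realType) (T : topologicalType) (X : set T)
    (d : T -> CC R) (a : CC R) (p : T -> CC R) : Prop :=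
  exists L : T -> CC R, {within X, continuous L} /\
    forall x, X x -> d x = cexp (L x) /\ p x = cexp (a * L x).

(* Functions on X are represented by functions on the ambient type T of which
   only the values on X are relevant: H is saturated for equality on X, and
   f, g in H are identified exactly when they agree on X. *)
Record hilbert_function_space (R : realType) (T : Type) (X : set T)
    (H : set (T -> CC R)) (ip : (T -> CC R) -> (T -> CC R) -> CC R) : Prop := {
  hfs_sat : forall f g, H f -> (forall x, X x -> f x = g x) -> H g ;
  hfs_zero : H (fun=> 0) ;
  hfs_lin : forall (a : CC R) f g, H f -> H g -> H (fun x => a * f x + g x) ;
  hfs_ip_lin : forall (a : CC R) f g h, H f -> H g -> H h ->
    ip (fun x => a * f x + g x) h = a * ip f h + ip g h ;
  hfs_ip_conj : forall f g, H f -> H g -> ip g f = Num.conj (ip f g) ;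
  hfs_ip_ge0 : forall f, H f -> 0 <= ip f f ;
  hfs_ip_def : forall f, H f -> (ip f f = 0 <-> forall x, X x -> f x = 0) ;
  hfs_complete : forall u : nat -> T -> CC R, (forall n, H (u n)) ->
    (forall e : R, 0 < e -> exists N : nat, forall m n : nat,
       (N <= m)%N -> (N <= n)%N -> ip (u m \- u n) (u m \- u n) < e%:C) ->
    exists2 f, H f & (fun n => ip (u n \- f) (u n \- f)) @ \oo --> (0 : CC R) }.

Definition reproducing_kernel (R : realType) (T : Type) (X : set T)
    (H : set (T -> CC R)) (ip : (T -> CC R) -> (T -> CC R) -> CC R)
    (k : T -> T -> CC R) : Prop :=
  forall w, X w -> H (k ^~ w) /\ forall f, H f -> ip f (k ^~ w) = f w.

Definition kernel_cartanII (R : realType) (k : C3 R -> C3 R -> CC R) : Prop :=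
  exists p : C3 R * C3 R -> CC R,
  [/\ continuous_power (@cartanII R `*` @cartanII R)
        (fun x => \det (1%:M - symmx x.1 *m map_mx Num.conj (symmx x.2)))
        (- (3%:R / 2%:R)) p,
      forall z, cartanII z -> p (z, 0) = 1 &
      forall z w, cartanII z -> cartanII w ->
        k z w = ((vol_cartanII R)^-1)%:C * p (z, w)].

(* H, with inner product ip, is the Hardy space of cartanII. A Hilbert function
   space is determined, inner product included, by its reproducing kernel. *)
Definition hardy_cartanII (R : realType) (H : set (C3 R -> CC R))
    (ip : (C3 R -> CC R) -> (C3 R -> CC R) -> CC R) : Prop :=
  [/\ hilbert_function_space (@cartanII R) H ip,
      forall f, H f -> holomorphic_on (@cartanII R) f &
      exists k, kernel_cartanII k /\ reproducing_kernel (@cartanII R) H ip k].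

Definition phi (R : realType) (z : C3 R) : C3 R :=
  vec3 (z 0 0) (z 0 1) (z 0 0 * z 0 1 - z 0 2%:R ^+ 2).

(* The Jacobian determinant of phi. *)
Definition Jphi (R : realType) (z : C3 R) : CC R := - (2%:R * z 0 2%:R).

Definition pullback (R : realType) (f : C3 R -> CC R) : C3 R -> CC R :=
  fun z => Jphi z * f (phi z).

(* k is the reproducing kernel of the space of holomorphic f on the tetrablock
   with pullback f in the Hardy space of cartanII; its inner product is the one
   (unique by polarization) inducing the norm |pullback f|. *)
Definition szego_tetrablock (R : realType) (k : C3 R -> C3 R -> CC R) : Prop :=
  exists H ip, hardy_cartanII H ip /\
    reproducing_kernel (@tetrablock R)
      [set f | holomorphic_on (@tetrablock R) f /\ H (pullback f)]
      (fun f g => ip (pullback f) (pullback g)) k.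

Definition sigma (R : realType) (z : C3 R) : C3 R :=
  vec3 (z 0 0) (z 0 1) (- z 0 2%:R).

(* Main.v *)
Require Import Defs.
From HB Require Import structures.
From mathcomp Require Import all_boot all_order all_algebra.
From mathcomp Require Import complex.
From mathcomp Require Import all_classical all_reals all_analysis.
From mathcomp Require Import ring lra zify.

Set Implicit Arguments.
Unset Strict Implicit.
Unset Printing Implicit Defensive.

Import Order.TTheory GRing.Theory Num.Theory.
Import numFieldNormedType.Exports.

Local Open Scope classical_set_scope.
Local Open Scope complex_scope.
Local Open Scope ring_scope.

(** Write [zeta = phi z], [omega = phi w] with [z], [w] in the Cartan domain,
    and [a = 1 - <sigma zeta, omega>], [b = 2 z_3 conj w_3]. The determinant in
    the kernel of the Hardy space is [a - b] ([det_kernel]), and replacing [w] by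
    its mirror image [w' = (w_1, w_2, - w_3)], which has the same image under
    [phi], turns it into [a + b]. Moreover [z_3 ^ 2 = zeta_1 zeta_2 - zeta_3], so
    [a ^ 2 - b ^ 2] is the discriminant [D] of the statement.

    A function of the form [Jphi * (f \o phi)] is odd in [z_3]. It is therefore
    reproduced at [w] by half the difference of the kernel sections over [w] and
    [w'], that is, up to the volume, by half of
    [(a - b) ^ (-3/2) - (a + b) ^ (-3/2)]. Once this difference is itself known
    to be a multiple of [Jphi * (F \o phi)] for some [F] holomorphic on the
    tetrablock, orthogonality forces [F] to be a multiple of the Szegő kernel
    ([szego_of_antisymmetric]). The multiple comes out as twice the volume of the
    Cartan domain, which is positive and finite because the domain lies between
    two boxes ([vol_cartanII_gt0]).

    What [F] is can be read off from an identity between square roots. With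
    [r = sqrt D] one has
    [(a + b) ^ (3/2) - (a - b) ^ (3/2) = 2 b (2 a + r) / sqrt (2 a + 2 r)],
    hence [F] is, up to constants, [(2 a + r) / (sqrt (2 a + 2 r) * r ^ 3)]
    ([closed_form], [inv_cube_csqrtB]). It involves only square roots of functions
    of [zeta] with positive real part, provided [omega] is small, so it is
    visibly holomorphic on the whole tetrablock, also where [z_3] vanishes
    ([szego_form_holomorphic]).

    The series of the statement is the odd part of the binomial series of
    [(1 + b / a) ^ (3/2)], and sums to the same left-hand side
    ([closed_form_series]). The binomial series is obtained without
    differentiation: by Vandermonde's identity the partial sums for the exponent
    1/2 square to [1 + y] up to high order, and Pascal's rule leads from the
    exponent 1/2 to 3/2.

    The kernel is given through an arbitrary continuous branch of the power
    -3/2. Along the segment joining [w] to [0] the determinant stays in the right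
    half-plane, so that branch agrees there with the principal one
    ([principal_branch], [kernel_cartanII_principal]). *)

(** * Complex modulus, exponential and square root *)

Local Notation cnorm := (@Normc.normc _).

Section ComplexModulus.
Variable R : realType.
Implicit Types x y z : CC R.

Lemma cnormE x : `|x| = (cnorm x)%:C.
Proof. by case: x. Qed.

Lemma cnorm0 : cnorm (0 : CC R) = 0.
Proof. exact: Normc.normc0. Qed.

Lemma cnorm1 : cnorm (1 : CC R) = 1.
Proof. exact: Normc.normc1. Qed.

Lemma cnormN x : cnorm (- x) = cnorm x.
Proof. exact: normcN. Qed.

Lemma cnormM x y : cnorm (x * y) = cnorm x * cnorm y.
Proof. exact: Normc.normcM. Qed.

Lemma cnormV x : cnorm x^-1 = (cnorm x)^-1.
Proof. exact: Normc.normcV. Qed.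

Lemma cnorm_ge0 x : 0 <= cnorm x.
Proof. by case: x => a b; exact: sqrtr_ge0. Qed.

Lemma cnormD x y : cnorm (x + y) <= cnorm x + cnorm y.
Proof. exact: le_normcD. Qed.

Lemma cnormB x y : cnorm (x - y) <= cnorm x + cnorm y.
Proof. by rewrite -[cnorm y]cnormN; exact: le_normcD. Qed.

Lemma cnormX x n : cnorm (x ^+ n) = cnorm x ^+ n.
Proof. by elim: n => [|n IH]; rewrite ?expr0 ?cnorm1 // !exprS cnormM IH. Qed.

Lemma cnorm_real (a : R) : cnorm (a%:C : CC R) = `|a|.
Proof. by rewrite /= expr0n /= addr0 sqrtr_sqr. Qed.

Lemma cnorm_nat n : cnorm (n%:R : CC R) = n%:R.
Proof. by rewrite -(rmorph_nat (real_complex R)) cnorm_real ger0_norm. Qed.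

Lemma cnorm_conj x : cnorm (Num.conj x) = cnorm x.
Proof.
apply: complexI; rewrite -!cnormE; exact: norm_conjC.
Qed.

Lemma cnorm_gt0 x : x != 0 -> 0 < cnorm x.
Proof.
move=> x0; rewrite lt_neqAle cnorm_ge0 andbT eq_sym.
by apply: contra x0 => /eqP/Normc.eq0_normc ->.
Qed.

Lemma Re_cnorm x : `|complex.Re x| <= cnorm x.
Proof. by rewrite -lecR -cnormE; exact: normc_ge_Re. Qed.

Lemma Im_cnorm x : `|complex.Im x| <= cnorm x.
Proof.
case: x => a b /=; rewrite -[leLHS]sqrtr_sqr.
by apply: ler_wsqrtr; rewrite lerDr sqr_ge0.
Qed.

Lemma cnorm_ReIm x : cnorm x <= `|complex.Re x| + `|complex.Im x|.
Proof.
case: x => a b /=.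
rewrite -(@ger0_norm _ (`|a| + `|b|)) ?addr_ge0 // -[leRHS]sqrtr_sqr.
apply: ler_wsqrtr; rewrite sqrrD !real_normK ?num_real //.
by have := mulr_ge0 (normr_ge0 a) (normr_ge0 b); lra.
Qed.

Lemma ReD x y : complex.Re (x + y) = complex.Re x + complex.Re y.
Proof. by case: x y => [a b] [c d]. Qed.

Lemma ReN x : complex.Re (- x) = - complex.Re x.
Proof. by case: x. Qed.

Lemma ImB x y : complex.Im (x - y) = complex.Im x - complex.Im y.
Proof. by case: x y => [a b] [c d]. Qed.

Lemma ReM x y : complex.Re (x * y) =
  complex.Re x * complex.Re y - complex.Im x * complex.Im y.
Proof. by case: x y => [a b] [c d]. Qed.

Lemma Re_near1 x (e : R) : cnorm (x - 1) <= e -> 1 - e <= complex.Re x.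
Proof.
move=> xe; have := le_trans (Re_cnorm _) xe.
by case: {xe} x => a b; rewrite /= ler_norml => /andP[]; lra.
Qed.

Lemma Re_gt0_neq0 x : 0 < complex.Re x -> x != 0.
Proof. by move=> h; apply/eqP => x0; rewrite x0 ltxx in h. Qed.

Lemma slit_plane_Re_gt0 x : 0 < complex.Re x -> slit_plane x.
Proof. by case: x => a b /= a0; rewrite /slit_plane /= lecE /= leNgt a0 andbF. Qed.

Lemma sqr_inj_Re_gt0 x y : 0 < complex.Re x -> 0 < complex.Re y ->
  x ^+ 2 = y ^+ 2 -> x = y.
Proof.
move=> x0 y0 /eqP; rewrite eqf_sqr => /orP[/eqP //|/eqP xy].
by move: x0 y0; rewrite xy; case: y {xy} => a b; rewrite /= oppr_gt0 => /lt_trans h /h; rewrite ltxx.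
Qed.

(** The sector of half-angle pi/4 around the positive reals is what squares
    into the right half-plane, and a product of two of its elements stays in
    the right half-plane. *)
Lemma Re_mul_gt0 x y : 0 < complex.Re x -> 0 < complex.Re y ->
  0 < complex.Re (x ^+ 2) -> 0 < complex.Re (y ^+ 2) ->
  0 < complex.Re (x * y).
Proof.
rewrite !expr2 !ReM; case: x y => [a b] [c d] /= a0 c0 ha hc.
have hb : `|b| < a by rewrite -ltr_sqr ?nnegrE ?normr_ge0 ?ltW // real_normK ?num_real // !expr2; lra.
have hd : `|d| < c by rewrite -ltr_sqr ?nnegrE ?normr_ge0 ?ltW // real_normK ?num_real // !expr2; lra.
rewrite subr_gt0; apply: le_lt_trans (ler_norm _) _; rewrite normrM.
by apply: ltr_pM.
Qed.

Lemma cnorm_sum (I : Type) (s : seq I) (F : I -> CC R) :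
  cnorm (\sum_(i <- s) F i) <= \sum_(i <- s) cnorm (F i).
Proof.
elim/big_ind2: _ => [|x1 x2 y1 y2 h1 h2|//]; first by rewrite cnorm0.
by apply: le_trans (cnormD _ _) _; apply: lerD.
Qed.

Lemma Re_addr_gt0 x y : cnorm (x - 1) <= 4^-1 -> cnorm y <= 4^-1 ->
  0 < complex.Re (x + y).
Proof.
move=> hx hy; have : cnorm (x + y - 1) <= 1 / 2.
  by rewrite addrAC; apply: le_trans (cnormD _ _) _; lra.
by move/Re_near1; lra.
Qed.

End ComplexModulus.

Section ComplexExponential.
Variable R : realType.
Implicit Types x y z : CC R.

Lemma cexpD x y : cexp (x + y) = cexp x * cexp y.
Proof.
case: x y => [a b] [c d]; rewrite /cexp /= expRD cosD sinD rmorphM /=.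
set u := cos b +i* sin b; set v := cos d +i* sin d.
have -> : (cos b * cos d - sin b * sin d) +i* (sin b * cos d + cos b * sin d) =
  u * v by rewrite [sin b * cos d + _]addrC.
by rewrite mulrACA.
Qed.

Lemma cexp0 : cexp (0 : CC R) = 1.
Proof. by rewrite /cexp /= expR0 cos0 sin0 !rmorph1 mul1r. Qed.

Lemma cexpMn n x : cexp (n%:R * x) = cexp x ^+ n.
Proof.
elim: n => [|n IH]; first by rewrite mul0r cexp0 expr0.
by rewrite -addn1 natrD mulrDl mul1r cexpD IH exprD expr1.
Qed.

Lemma cexp_neq0 x : cexp x != 0.
Proof.
apply/eqP => x0; have := cexpD x (- x).
by rewrite subrr cexp0 x0 mul0r => /eqP; rewrite oner_eq0.
Qed.

Lemma cexpN x : cexp (- x) = (cexp x)^-1.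
Proof.
apply: (mulfI (cexp_neq0 x)); rewrite -cexpD subrr cexp0 mulfV //.
exact: cexp_neq0.
Qed.

Lemma cnorm_cos_bound z : z != 0 ->
  -1 <= complex.Re z / cnorm z <= 1.
Proof.
move=> z0; have n0 := cnorm_gt0 z0.
by rewrite -ler_norml normrM normfV [`|cnorm z|]ger0_norm ?cnorm_ge0 //
  ler_pdivrMr // mul1r Re_cnorm.
Qed.

Lemma cos_carg z : z != 0 -> cos (carg z) = complex.Re z / cnorm z.
Proof.
move=> z0; rewrite /carg; case: ifP => _; rewrite ?cosN acosK // in_itv /=;
exact: cnorm_cos_bound.
Qed.

Lemma sin_carg z : z != 0 -> sin (carg z) = complex.Im z / cnorm z.
Proof.
move=> z0; have n0 := cnorm_gt0 z0.
have sE : sin (acos (complex.Re z / cnorm z)) =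
    `|complex.Im z| / cnorm z.
  rewrite sin_acos ?cnorm_cos_bound //.
  have -> : 1 - (complex.Re z / cnorm z) ^+ 2 =
      (complex.Im z / cnorm z) ^+ 2.
    apply: (mulIf (x := cnorm z ^+ 2)); first by rewrite expf_neq0 ?gt_eqF.
    rewrite mulrBl mul1r -!exprMn !divfK ?gt_eqF //.
    case: {n0} z z0 => a b _ /=.
    by rewrite sqr_sqrtr ?addr_ge0 ?sqr_ge0 //; ring.
  by rewrite sqrtr_sqr normrM normfV [`|cnorm z|]ger0_norm ?cnorm_ge0.
rewrite /carg; case: ifPn => [i0|]; rewrite ?sinN sE.
  by rewrite ger0_norm.
by rewrite -ltNge => i0; rewrite ltr0_norm // mulNr opprK.
Qed.

Lemma cexp_clog z : z != 0 -> cexp (clog z) = z.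
Proof.
move=> z0; rewrite /cexp /= lnK ?posrE ?cnorm_gt0 // cos_carg // sin_carg //.
have n0 := cnorm_gt0 z0.
move: n0; case: z z0 => a b _; set n := cnorm _ => n0.
have E u : n * (u / n) = u by rewrite mulrC divfK ?gt_eqF.
by apply/eqP; rewrite eq_complex /= !mul0r subr0 addr0 !E !eqxx.
Qed.

(** The square root in which all fractional powers below are expressed. *)
Definition csqrt z : CC R := cpow z (1 / 2%:R).

Lemma sqr_csqrt z : z != 0 -> csqrt z ^+ 2 = z.
Proof.
move=> z0; rewrite /csqrt /cpow -cexpMn mulrA mulrCA divff ?pnatr_eq0 //.
by rewrite mulr1 mul1r cexp_clog.
Qed.

Lemma csqrt_neq0 z : csqrt z != 0.
Proof. exact: cexp_neq0. Qed.

Lemma Re_csqrt_gt0 z : 0 < complex.Re z -> 0 < complex.Re (csqrt z).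
Proof.
move=> z0; have zn0 := Re_gt0_neq0 z0; have n0 := cnorm_gt0 zn0.
have half : (1 / 2%:R : CC R) = (2^-1 : R)%:C.
  by rewrite div1r fmorphV rmorph_nat.
rewrite /csqrt /cpow half /cexp ReM /= !mul0r !subr0 addr0.
rewrite mulr_gt0 ?expR_gt0 // cos_gt0_pihalf //.
have cosp : 0 < complex.Re z / cnorm z by rewrite divr_gt0.
have b := cnorm_cos_bound zn0.
have a0 := acos_ge0 b.
have api : acos (complex.Re z / cnorm z) < pi.
  by apply: acos_ltpi; case/andP: b => _ ->; rewrite andbT; lra.
by rewrite /carg; case: ifP => _; lra.
Qed.

Lemma csqrt_unique z x : 0 < complex.Re x -> 0 < complex.Re z -> x ^+ 2 = z ->
  csqrt z = x.
Proof.
move=> x0 z0 xz; apply: sqr_inj_Re_gt0; rewrite ?Re_csqrt_gt0 //.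
by rewrite sqr_csqrt ?Re_gt0_neq0.
Qed.

Lemma cpow_3half z : cpow z (3%:R / 2%:R) = csqrt z ^+ 3.
Proof. by rewrite /csqrt /cpow -cexpMn mulrA mulrA mulr1. Qed.

Lemma cpow_half_even z k : z != 0 ->
  cpow z (3%:R / 2%:R - (2 * k)%:R - 1) = csqrt z / z ^+ (2 * k).
Proof.
move=> z0; rewrite /csqrt /cpow.
have -> : (3%:R / 2%:R - (2 * k)%:R - 1) * clog z =
  (1 / 2%:R) * clog z - (2 * k)%:R * clog z :> CC R by field.
by rewrite cexpD cexpN cexpMn cexp_clog.
Qed.

End ComplexExponential.

(** * Topology of the complex numbers and branches of powers *)

Section ComplexTopology.
Variable R : realType.
Implicit Types z l : CC R.

(** The norm of [CC R] takes values in [CC R] itself; this is the bridge to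
    limits of real numbers. *)
Lemma cvg_cnormP (T : Type) (F : set_system T) {FF : Filter F}
    (f : T -> CC R) l :
  f @ F --> l <-> cnorm (f x - l) @[x --> F] --> (0 : R).
Proof.
split=> [/cvgrPdist_lt h|/cvgrPdist_lt h]; apply/cvgrPdist_lt => e e0.
  have e0' : 0 < e%:C :> CC R by rewrite ltcR.
  near=> x; rewrite sub0r normrN ger0_norm ?cnorm_ge0 // -cnormN opprB.
  by rewrite -ltcR -cnormE; near: x; exact: h.
have eE : e = (complex.Re e)%:C by apply/esym/RRe_real; exact: gtr0_real.
have e0' : 0 < complex.Re e by rewrite -ltcR -eE.
near=> x; rewrite eE cnormE ltcR -[_ - f x]opprB cnormN.
have : `|0 - cnorm (f x - l)| < complex.Re e by near: x; exact: h.
by rewrite sub0r normrN ger0_norm ?cnorm_ge0.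
Unshelve. all: by end_near.
Qed.

Lemma cvg_of_cnorm_le (T : Type) (F : set_system T) {FF : Filter F}
    (f : T -> CC R) l (g : T -> R) :
  (\forall x \near F, cnorm (f x - l) <= g x) -> g @ F --> (0 : R) -> f @ F --> l.
Proof.
move=> h g0; apply/cvg_cnormP.
apply: (squeeze_cvgr _ (cvg_cst 0) g0).
by near=> x; rewrite cnorm_ge0 /=; near: x.
Unshelve. all: by end_near.
Qed.

Lemma cvg_Re (T : Type) (F : set_system T) {FF : Filter F} (f : T -> CC R) l :
  f @ F --> l -> complex.Re (f x) @[x --> F] --> complex.Re l.
Proof.
move=> /cvg_cnormP /cvgrPdist_lt h; apply/cvgrPdist_lt => e e0.
near=> x.
have : `|0 - cnorm (f x - l)| < e by near: x; exact: h.
rewrite sub0r normrN ger0_norm ?cnorm_ge0 //; apply: le_lt_trans.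
by have := Re_cnorm (f x - l); rewrite ReD ReN -normrN opprB.
Unshelve. all: by end_near.
Qed.

Lemma cvg_Im (T : Type) (F : set_system T) {FF : Filter F} (f : T -> CC R) l :
  f @ F --> l -> complex.Im (f x) @[x --> F] --> complex.Im l.
Proof.
move=> /cvg_cnormP /cvgrPdist_lt h; apply/cvgrPdist_lt => e e0.
near=> x.
have : `|0 - cnorm (f x - l)| < e by near: x; exact: h.
rewrite sub0r normrN ger0_norm ?cnorm_ge0 //; apply: le_lt_trans.
by have := Im_cnorm (f x - l); rewrite ImB -normrN opprB.
Unshelve. all: by end_near.
Qed.

Lemma cvg_complex (T : Type) (F : set_system T) {FF : Filter F}
    (f g : T -> R) (a b : R) : f @ F --> a -> g @ F --> b ->
  (f x +i* g x : CC R) @[x --> F] --> (a +i* b : CC R).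
Proof.
move=> fa gb.
apply: (@cvg_of_cnorm_le _ _ _ _ _ (fun x => `|f x - a| + `|g x - b|)).
  by near=> x; exact: cnorm_ReIm.
rewrite -[X in _ --> X]addr0; apply: cvgD.
  by rewrite -(normr0 R) -(subrr a); apply: cvg_norm; apply: cvgB => //; exact: cvg_cst.
by rewrite -(normr0 R) -(subrr b); apply: cvg_norm; apply: cvgB => //; exact: cvg_cst.
Unshelve. all: by end_near.
Qed.

Lemma Re_continuous : continuous (fun z : CC R => complex.Re z).
Proof. by move=> z; apply: (@cvg_Re _ (nbhs z) _ id); exact: cvg_id. Qed.

Lemma Im_continuous : continuous (fun z : CC R => complex.Im z).
Proof. by move=> z; apply: (@cvg_Im _ (nbhs z) _ id); exact: cvg_id. Qed.

Lemma cexp_continuous : continuous (@cexp R).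
Proof.
have -> : @cexp R = fun z : CC R =>
  (expR (complex.Re z) * cos (complex.Im z)) +i* (expR (complex.Re z) * sin (complex.Im z)).
  apply/funext => -[a b]; rewrite /cexp /=.
  by apply/eqP; rewrite eq_complex /= !mul0r subr0 addr0 !eqxx.
move=> z; have cR := @Re_continuous z; have cI := @Im_continuous z.
have cE : (fun x : CC R => expR (complex.Re x)) @ z --> expR (complex.Re z).
  exact: (cvg_comp _ _ cR (@continuous_expR R (complex.Re z))).
have cC : (fun x : CC R => cos (complex.Im x)) @ z --> cos (complex.Im z).
  exact: (cvg_comp _ _ cI (@continuous_cos R (complex.Im z))).
have cS : (fun x : CC R => sin (complex.Im x)) @ z --> sin (complex.Im z).
  exact: (cvg_comp _ _ cI (@continuous_sin R (complex.Im z))).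
exact: (cvg_complex (cvgM cE cC) (cvgM cE cS)).
Qed.

Lemma near_Re_gt0 z : 0 < complex.Re z ->
  \forall x \near (nbhs z), 0 < complex.Re x.
Proof. by move=> z0; move/cvgr_gt: (@Re_continuous z); apply. Qed.

Lemma csqrtB (x y : CC R) : 0 < complex.Re x -> 0 < complex.Re y ->
  (csqrt x - csqrt y) * (csqrt x + csqrt y) = x - y.
Proof. by move=> x0 y0; rewrite -subr_sqr !sqr_csqrt ?Re_gt0_neq0. Qed.

Lemma csqrt_continuous z : 0 < complex.Re z -> {for z, continuous (@csqrt R)}.
Proof.
move=> z0; have s0 := Re_csqrt_gt0 z0.
apply: (@cvg_of_cnorm_le _ (nbhs z) _ _ _ (fun x => cnorm (x - z) * (complex.Re (csqrt z))^-1)).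
  near=> x; have x0 : 0 < complex.Re x by near: x; exact: near_Re_gt0.
  rewrite ler_pdivlMr // -(csqrtB x0 z0) cnormM ler_wpM2l ?cnorm_ge0 //.
  apply: le_trans (le_trans (ler_norm _) (Re_cnorm _)).
  by rewrite ReD lerDr ltW // Re_csqrt_gt0.
rewrite -(mul0r (complex.Re (csqrt z))^-1); apply: cvgM; last exact: cvg_cst.
by apply/(cvg_cnormP id); exact: cvg_id.
Unshelve. all: by end_near.
Qed.

Lemma csqrt_differentiable z : 0 < complex.Re z -> differentiable (@csqrt R) z.
Proof.
move=> z0; apply/derivable1_diffP/cvg_ex.
exists ((csqrt z + csqrt z)^-1).
have s0 := Re_csqrt_gt0 z0.
have hz : (fun h : CC R => h *: (1 : CC R) + z) @ (0 : CC R)^' --> z.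
  have : (fun h : CC R => h *: (1 : CC R) + z) @ (0 : CC R) --> 0 *: (1 : CC R) + z.
    apply: (cvgD (@cvgZr_tmp (CC R) (CC R) (CC R) (nbhs (0 : CC R)) _ id 0 1 _) (cvg_cst z)).
    exact: cvg_id.
  by rewrite scale0r add0r => h; apply: cvg_within_filter.
apply: (@cvg_trans _ ((fun h : CC R => (csqrt (h *: (1 : CC R) + z) + csqrt z)^-1) @ (0 : CC R)^')).
  apply: near_eq_cvg; near=> h.
  have h0 : h != 0 by near: h; exact: nbhs_dnbhs_neq.
  have x0 : 0 < complex.Re (h *: (1 : CC R) + z).
    by near: h; exact: (hz _ (near_Re_gt0 z0)).
  have n0 : csqrt (h *: (1 : CC R) + z) + csqrt z != 0.
    by apply: Re_gt0_neq0; rewrite ReD addr_gt0 ?Re_csqrt_gt0.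
  apply: (mulIf n0); rewrite mulVf // -[X in _ = X * _]/(h^-1 * _) -mulrA csqrtB //.
  by rewrite addrK -[X in _ * X]/(h * 1) mulr1 mulVf.
apply: cvgV; first by apply: Re_gt0_neq0; rewrite ReD addr_gt0.
apply: cvgD; last exact: cvg_cst.
by apply: (cvg_comp _ _ hz); exact: csqrt_continuous.
Unshelve. all: by end_near.
Qed.

(** A continuous branch of [d ^ (-3/2)] along a path in the right half-plane
    differs from the principal one by a continuous sign, which is constant. *)
Lemma principal_branch (L d : R -> CC R) (t0 t1 : R) : t0 <= t1 ->
  continuous L -> (forall t, d t = cexp (L t)) ->
  (forall t, 0 < complex.Re (d t)) ->
  cexp (- (3%:R / 2%:R) * L t0) = csqrt (d t0) ^- 3 ->
  cexp (- (3%:R / 2%:R) * L t1) = csqrt (d t1) ^- 3.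
Proof.
move=> t01 cL dL d0 h0.
have cd : continuous d.
  move=> t; rewrite (_ : d = @cexp R \o L); last by apply/funext => s; rewrite dL.
  exact: (cvg_comp _ _ (cL t) (@cexp_continuous (L t))).
(* the ratio of two square roots of d t, hence 1 or - 1 *)
pose u t := cexp (- (1 / 2%:R) * L t) * csqrt (d t).
have u2 t : u t ^+ 2 = 1.
  rewrite /u exprMn -cexpMn sqr_csqrt ?Re_gt0_neq0 // dL -cexpD.
  by rewrite [X in cexp X](_ : _ = 0) ?cexp0 //; field.
have u1 t : u t = 1 \/ u t = -1.
  by have /eqP := u2 t; rewrite sqrf_eq1 => /orP[/eqP|/eqP]; [left|right].
have uE t : cexp (- (3%:R / 2%:R) * L t) = u t * csqrt (d t) ^- 3.
  have -> : u t = u t ^+ 3 by rewrite [RHS]exprS u2 mulr1.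
  rewrite /u exprMn -cexpMn mulfK ?expf_neq0 ?csqrt_neq0 //.
  by congr cexp; ring.
have n0 t : csqrt (d t) ^- 3 != 0 by rewrite invr_neq0 // expf_neq0 // csqrt_neq0.
have ut0 : u t0 = 1 by apply: (mulIf (n0 t0)); rewrite -uE mul1r.
have [ut1|ut1] := u1 t1; first by rewrite uE ut1 mul1r.
have cu : continuous (fun t => complex.Re (u t)).
  move=> t; apply: cvg_Re; apply: cvgM.
    apply: (@cvg_comp _ _ _ (fun t => - (1 / 2%:R) * L t) (@cexp R)); last exact: cexp_continuous.
    by apply: cvgM; [exact: cvg_cst|exact: cL].
  exact: (cvg_comp _ _ (cd t) (csqrt_continuous (d0 t))).
have [] := @IVT R (fun t => complex.Re (u t)) t0 t1 0 t01.
- exact: continuous_subspaceT.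
- by rewrite ut0 ut1 /= ge_min le_max !ler01 lerN10 ?orbT.
- by move=> t _; have [->|->] /= := u1 t => /eqP; rewrite ?oppr_eq0 oner_eq0.
Qed.

End ComplexTopology.

(** * The binomial series with exponent 3/2 *)

Section GeneralizedBinomial.
Variable R : realType.
Implicit Types a b y : CC R.

Lemma gbinom0 a : gbinom a 0 = 1.
Proof. by rewrite /gbinom big_ord0 fact0 divr1. Qed.

Lemma gbinomS a n : n.+1%:R * gbinom a n.+1 = (a - n%:R) * gbinom a n.
Proof.
rewrite /gbinom big_ord_recr /= factS natrM; field.
by rewrite [1 + _]addrC natr1 !pnatr_eq0 -!lt0n fact_gt0.
Qed.

Lemma gbinomDr1 a n : gbinom (a + 1) n.+1 = gbinom a n.+1 + gbinom a n.
Proof.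
have E : \prod_(i < n.+1) (a + 1 - i%:R) = (a + 1) * \prod_(i < n) (a - i%:R).
  rewrite big_ord_recl /= subr0; congr (_ * _); apply: eq_bigr => i _.
  by rewrite /bump leq0n add1n -natr1; ring.
rewrite /gbinom E big_ord_recr /= factS natrM; field.
by rewrite [1 + n%:R]addrC natr1 !pnatr_eq0 -!lt0n fact_gt0.
Qed.

(** Both sides of Vandermonde's identity satisfy the first order recurrence
    [gbinomS] in [n], which reduces the identity to the case [n = 0]. *)
Lemma gbinom_vandermonde a b n :
  \sum_(i < n.+1) gbinom a i * gbinom b (n - i) = gbinom (a + b) n.
Proof.
elim: n => [|n IH]; first by rewrite big_ord1 !gbinom0 mulr1.
have n0 : n.+1%:R != 0 :> CC R by rewrite pnatr_eq0.
apply: (mulfI n0); rewrite gbinomS -IH !mulr_sumr.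
have E (i : 'I_n.+2) : n.+1%:R * (gbinom a i * gbinom b (n.+1 - i)) =
   i%:R * gbinom a i * gbinom b (n.+1 - i) +
   gbinom a i * ((n.+1 - i)%:R * gbinom b (n.+1 - i)).
  have -> : n.+1%:R = i%:R + (n.+1 - i)%:R :> CC R.
    by rewrite -natrD subnKC // -ltnS.
  by ring.
rewrite (eq_bigr _ (fun i _ => E i)) big_split /=.
rewrite big_ord_recl /= mul0r mul0r add0r.
rewrite [X in _ + X]big_ord_recr /= subnn mul0r mulr0 addr0 -big_split /=.
apply: eq_bigr => i _; rewrite /bump leq0n add1n gbinomS subSS.
have le_in : (i <= n)%N by rewrite -ltnS.
rewrite subSn // gbinomS natrB //; ring.
Qed.

Lemma gbinom1 n : gbinom (1 : CC R) n = (n < 2)%:R.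
Proof.
case: n => [|[|n]]; first exact: gbinom0.
  by rewrite /gbinom big_ord1 subr0 divr1.
apply/eqP; rewrite /gbinom mulf_eq0; apply/orP; left.
rewrite prodf_seq_eq0; apply/hasP; exists (inord 1); rewrite ?mem_index_enum //.
by rewrite inordK //= subrr.
Qed.

Lemma cnorm_gbinom_half n : cnorm (gbinom (1 / 2%:R : CC R) n) <= 1.
Proof.
elim: n => [|n IH]; first by rewrite gbinom0 cnorm1.
have E : n.+1%:R * cnorm (gbinom (1 / 2%:R : CC R) n.+1) =
  cnorm (1 / 2%:R - n%:R : CC R) * cnorm (gbinom (1 / 2%:R : CC R) n).
  by rewrite -cnormM -gbinomS cnormM cnorm_nat.
have F : cnorm (1 / 2%:R - n%:R : CC R) <= n.+1%:R.
  apply: le_trans (cnormB _ _) _; rewrite cnorm_nat div1r cnormV cnorm_nat.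
  by rewrite -(natr1 n); lra.
have n0 : 0 < n.+1%:R :> R by rewrite ltr0n.
rewrite -(ler_pM2l n0) E mulr1.
by rewrite -[leRHS]mulr1 ler_pM ?cnorm_ge0.
Qed.

Definition binom_sum a y N : CC R := \sum_(i < N) gbinom a i * y ^+ i.

Lemma binom_sumDr1 a y N :
  binom_sum (a + 1) y N.+1 = binom_sum a y N.+1 + y * binom_sum a y N.
Proof.
rewrite /binom_sum !big_ord_recl /= !gbinom0 -addrA; congr (_ + _).
rewrite mulr_sumr -big_split /=; apply: eq_bigr => i _.
by rewrite /bump leq0n add1n gbinomDr1 exprS; ring.
Qed.

Lemma binom_sum_odd a y N :
  binom_sum a y (2 * N) - binom_sum a (- y) (2 * N) =
  2%:R * \sum_(k < N) gbinom a (2 * k).+1 * y ^+ (2 * k).+1.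
Proof.
elim: N => [|N IH]; first by rewrite muln0 /binom_sum !big_ord0 subr0 mulr0.
rewrite mulnS /= /binom_sum !add2n !big_ord_recr /= -!/(binom_sum _ _ _) mulrDr -IH.
by rewrite !exprS !exprM sqrrN; ring.
Qed.

Let c (n : nat) : CC R := gbinom (1 / 2%:R) n.

Lemma cnorm_expr_le y n m (r : R) : cnorm y <= r -> r <= 1 ->
  (n <= m)%N -> cnorm (y ^+ m) <= r ^+ n.
Proof.
move=> yr r1 nm; rewrite cnormX.
have r0 := le_trans (cnorm_ge0 y) yr.
apply: (le_trans (y := r ^+ m)); first by apply: lerXn2r; rewrite ?nnegrE ?cnorm_ge0.
by apply: ler_wiXn2l.
Qed.

(** By Vandermonde, the square of the [N]-th partial sum of the binomial series
    of [(1 + y) ^ (1/2)] agrees with [1 + y] up to order [N]. *)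
Lemma sqr_binom_sum_half y N : (1 < N)%N -> cnorm y <= 16^-1 ->
  cnorm (binom_sum (1 / 2%:R) y N ^+ 2 - (1 + y)) <= 4 / 4 ^+ N.
Proof.
move=> N1 hy.
pose p : {poly CC R} := \poly_(i < N) c i.
pose E := p ^+ 2 - (1 + 'X).
have pE : p.[y] = binom_sum (1 / 2%:R) y N by rewrite horner_poly.
have -> : binom_sum (1 / 2%:R) y N ^+ 2 - (1 + y) = E.[y].
  by rewrite -pE /E !hornerE.
have sE : (size E <= 2 * N)%N.
  apply: leq_trans (size_polyD _ _) _; rewrite geq_max size_polyN; apply/andP; split.
    rewrite expr2; apply: leq_trans (size_polyMleq _ _) _.
    have : (size p <= N)%N by exact: size_poly.
    by lia.
  apply: leq_trans (size_polyD _ _) _; rewrite size_poly1 size_polyX; lia.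
have small i : (i < N)%N -> E`_i = 0.
  move=> iN; rewrite /E coefB coefD coef1 coefX expr2 coefM.
  have -> : \sum_(j < i.+1) p`_j * p`_(i - j) = gbinom (1 : CC R) i.
    rewrite -[1 in RHS](_ : 1 / 2%:R + 1 / 2%:R = 1 :> CC R); last by field.
    rewrite -gbinom_vandermonde; apply: eq_bigr => j _; rewrite !coef_poly.
    have -> : (j < N)%N by have := ltn_ord j; lia.
    by have -> : (i - j < N)%N by have := ltn_ord j; lia.
  by rewrite gbinom1; case: i iN => [|[|i]] _; rewrite /= ?mulr0n ?mulr1n ?addr0 ?add0r ?subrr ?subr0 ?oppr0 //.
have large i : (N <= i < 2 * N)%N -> cnorm E`_i <= 2 * N%:R.
  move=> /andP[Ni iN]; rewrite /E coefB coefD coef1 coefX expr2 coefM.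
  have -> : (i == 0)%N = false by lia.
  have -> : (i == 1)%N = false by lia.
  rewrite addr0 subr0; apply: le_trans (cnorm_sum _ _) _.
  apply: (@le_trans _ _ (\sum_(j < i.+1) 1)).
    apply: ler_sum => j _; rewrite cnormM -[leRHS]mulr1.
    apply: ler_pM; rewrite ?cnorm_ge0 // coef_poly; case: ifP => _;
      rewrite ?cnorm_gbinom_half // cnorm0 //.
  by rewrite sumr_const card_ord -natrM ler_nat.
rewrite (horner_coef_wide _ sE); apply: le_trans (cnorm_sum _ _) _.
apply: (@le_trans _ _ (\sum_(i < 2 * N) (2 * N%:R * 16^-1 ^+ N))).
  apply: ler_sum => i _; rewrite cnormM.
  have r0 : 0 <= 16^-1 ^+ N :> R by rewrite exprn_ge0 // invr_ge0.
  have [iN|Ni] := ltnP i N.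
    by rewrite small // cnorm0 mul0r mulr_ge0 // mulr_ge0.
  apply: ler_pM; rewrite ?cnorm_ge0 // ?large ?Ni ?ltn_ord //.
  by apply: cnorm_expr_le => //; lra.
rewrite sumr_const card_ord.
have N2 : N%:R <= 2 ^+ N :> R by rewrite -natrX ler_nat ltnW // ltn_expl.
have e : (16^-1 : R) ^+ N = (2 ^+ N)^-1 * (2 ^+ N)^-1 * (4 ^+ N)^-1.
  by rewrite -!exprVn -!exprMn; congr (_ ^+ _); field.
have u0 : 0 < 2 ^+ N :> R by rewrite exprn_gt0.
have v0 : 0 < (4 ^+ N)^-1 :> R by rewrite invr_gt0 exprn_gt0.
rewrite e -[X in X <= _]mulr_natr natrM.
have -> : 2 * N%:R * ((2 ^+ N)^-1 * (2 ^+ N)^-1 * (4 ^+ N)^-1) * (2 * N%:R) =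
  4 * ((N%:R / 2 ^+ N) * (N%:R / 2 ^+ N)) * (4 ^+ N)^-1 :> R by ring.
rewrite ler_pM2r // -[leRHS]mulr1 ler_pM2l // -[leRHS]mulr1.
have w0 : 0 <= N%:R / 2 ^+ N :> R by rewrite divr_ge0 // ltW.
have w1 : N%:R / 2 ^+ N <= 1 :> R by rewrite ler_pdivrMr // mul1r.
exact: ler_pM.
Qed.

Lemma Re_binom_sum_half y N : (0 < N)%N -> cnorm y <= 16^-1 ->
  1 / 2 <= complex.Re (binom_sum (1 / 2%:R) y N).
Proof.
move=> N0 hy; suff : cnorm (binom_sum (1 / 2%:R) y N - 1) <= 1 / 2 - 1 / 2 ^+ N.
  move=> h; have := Re_near1 h.
  have : 0 < 1 / 2 ^+ N :> R by rewrite divr_gt0 // exprn_gt0.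
  by lra.
elim: N N0 => // -[_ _|N IH _].
  by rewrite /binom_sum big_ord1 gbinom0 expr0 mulr1 subrr cnorm0; lra.
rewrite /binom_sum big_ord_recr /= -/(binom_sum _ _ _) addrAC.
apply: le_trans (cnormD _ _) _.
have := IH isT; set u := cnorm _ => hu.
have : cnorm (gbinom (1 / 2%:R) N.+1 * y ^+ N.+1) <= 1 / 2 ^+ N.+2.
  rewrite cnormM -[leRHS]mul1r; apply: ler_pM; rewrite ?cnorm_ge0 ?cnorm_gbinom_half //.
  apply: le_trans (cnorm_expr_le (r := 4^-1) (n := N.+1) _ _ _) _ => //; first by lra.
    by lra.
  rewrite div1r exprVn lef_pV2 ?posrE ?exprn_gt0 //.
  have -> : 4 = 2 ^+ 2 :> R by ring.
  by rewrite -exprM ler_eXn2l ?ltr1n //; lia.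
by rewrite [in leRHS]exprS invfM mul1r; move: hu; rewrite [in X in X -> _]div1r mul1r => hu; rewrite ?mul1r; lra.
Qed.

(** Two approximate square roots [S] and [P] of [1 + y] with [Re S >= 1/2] are
    close, because [S ^ 2 - P ^ 2 = (S - P) (S + P)]. *)
Lemma binom_sum_half_near y N : (1 < N)%N -> cnorm y <= 16^-1 ->
  cnorm (binom_sum (1 / 2%:R) y N - csqrt (1 + y)) <= 8 / 4 ^+ N.
Proof.
move=> N1 hy; have h := sqr_binom_sum_half N1 hy.
have hR := Re_binom_sum_half (ltnW N1) hy.
have y1 : 0 < complex.Re (1 + y).
  have := @Re_near1 _ (1 + y) 16^-1; rewrite addrAC subrr add0r => /(_ hy); lra.
move: h; rewrite -{1}(sqr_csqrt (Re_gt0_neq0 y1)) subr_sqr cnormM.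
set u := cnorm (_ - _); set v := cnorm _ => h.
have v2 : 1 / 2 <= v.
  have := le_trans (ler_norm _) (Re_cnorm (binom_sum (1 / 2%:R) y N + csqrt (1 + y))).
  by rewrite ReD -/v; have := Re_csqrt_gt0 y1; lra.
have u0 : 0 <= u by exact: cnorm_ge0.
have : u * (1 / 2) <= u * v by rewrite ler_wpM2l.
lra.
Qed.

Lemma binom_sum_3half_near y N : (1 < N)%N -> cnorm y <= 16^-1 ->
  cnorm (binom_sum (3%:R / 2%:R) y N.+1 - csqrt (1 + y) ^+ 3) <= 8 / 4 ^+ N.
Proof.
move=> N1 hy.
have y1 : 0 < complex.Re (1 + y).
  have := @Re_near1 _ (1 + y) 16^-1; rewrite addrAC subrr add0r => /(_ hy); lra.
have -> : 3%:R / 2%:R = 1 / 2%:R + 1 :> CC R by field.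
rewrite binom_sumDr1 exprS (sqr_csqrt (Re_gt0_neq0 y1)).
set P := csqrt _; set S1 := binom_sum _ _ _; set S := binom_sum _ _ _.
have -> : S1 + y * S - P * (1 + y) = (S1 - P) + y * (S - P) by ring.
apply: le_trans (cnormD _ _) _; rewrite cnormM.
have h1 := binom_sum_half_near (ltnW N1 : 1 < N.+1)%N hy.
have h2 := binom_sum_half_near N1 hy.
have : cnorm y * cnorm (S - P) <= 16^-1 * (8 / 4 ^+ N).
  by rewrite ler_pM ?cnorm_ge0.
move: h1; rewrite -/P -/S1 exprS invfM.
have : 0 < (4 ^+ N)^-1 :> R by rewrite invr_gt0 exprn_gt0.
lra.
Qed.

End GeneralizedBinomial.

Section OddBinomialSeries.
Variable R : realType.
Implicit Types y : CC R.

(** The odd part of the binomial series of [(1 + y) ^ (3/2)]. *)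
Lemma odd_binomial_series y : cnorm y <= 16^-1 ->
  (fun N : nat => 2%:R * \sum_(k < N) gbinom (3%:R / 2%:R) (2 * k).+1 * y ^+ (2 * k).+1)
    @ \oo --> csqrt (1 + y) ^+ 3 - csqrt (1 - y) ^+ 3.
Proof.
move=> hy; apply/cvg_cnormP.
have h0 : (fun N : nat => 16 * (2^-1 : R) ^+ N) @ \oo --> (0 : R).
  rewrite -[X in _ --> X](mulr0 16); apply: cvgMr.
  by apply: cvg_expr; rewrite ger0_norm; lra.
apply: (squeeze_cvgr _ (cvg_cst 0) h0).
near=> N; rewrite cnorm_ge0 /= -binom_sum_odd.
have N2 : (1 < N)%N by near: N; exists 2%N.
have E : (2 * N = (2 * N).-1.+1)%N by lia.
have M1 : (1 < (2 * N).-1)%N by lia.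
have := binom_sum_3half_near M1 hy.
have := @binom_sum_3half_near _ (- y) _ M1; rewrite cnormN => /(_ hy).
rewrite -!E; set A := binom_sum _ y _; set B := binom_sum _ (- y) _ => hB hA.
have -> : A - B - (csqrt (1 + y) ^+ 3 - csqrt (1 - y) ^+ 3) =
  (A - csqrt (1 + y) ^+ 3) - (B - csqrt (1 - y) ^+ 3) by ring.
apply: le_trans (cnormB _ _) _.
have : (4 ^+ (2 * N).-1)^-1 <= 2^-1 ^+ N :> R.
  rewrite -exprVn; apply: (@le_trans _ _ (2^-1 ^+ (2 * N).-1)).
    by apply: lerXn2r; rewrite ?nnegrE; lra.
  by apply: ler_wiXn2l; [lra|lra|lia].
lra.
Unshelve. all: by end_near.
Qed.

End OddBinomialSeries.

(** * The Cartan domain and its volume *)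

Section OperatorNorm.
Variable R : realType.

Lemma cnorm_le_enorm (n : nat) (x : 'cV[CC R]_n) i : cnorm (x i 0) <= enorm x.
Proof.
rewrite -[leLHS]ger0_norm ?cnorm_ge0 // -[leLHS]sqrtr_sqr /enorm; apply: ler_wsqrtr.
by rewrite (bigD1 i) //= lerDl; apply: sumr_ge0 => j _; exact: sqr_ge0.
Qed.

Lemma enorm_le_sum (n : nat) (x : 'cV[CC R]_n) :
  enorm x <= \sum_(i < n) cnorm (x i 0).
Proof.
have s0 : 0 <= \sum_(i < n) cnorm (x i 0) by apply: sumr_ge0 => i _; exact: cnorm_ge0.
rewrite -[leRHS]ger0_norm // -[leRHS]sqrtr_sqr /enorm; apply: ler_wsqrtr.
rewrite expr2 mulr_suml; apply: ler_sum => i _; rewrite expr2.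
apply: ler_wpM2l; first exact: cnorm_ge0.
by rewrite (bigD1 i) //= lerDl; apply: sumr_ge0 => j _; exact: cnorm_ge0.
Qed.

Lemma enorm_mulmx_le (n : nat) (A : 'M[CC R]_n) (x : 'cV[CC R]_n) :
  enorm x <= 1 -> enorm (A *m x) <= \sum_i \sum_j cnorm (A i j).
Proof.
move=> x1; apply: le_trans (enorm_le_sum _) _; apply: ler_sum => i _.
rewrite mxE; apply: le_trans (cnorm_sum _ _) _; apply: ler_sum => j _.
rewrite cnormM -[leRHS]mulr1; apply: ler_wpM2l; first exact: cnorm_ge0.
exact: le_trans (cnorm_le_enorm _ _) x1.
Qed.

Lemma opnorm_le_sum (n : nat) (A : 'M[CC R]_n) :
  opnorm A <= \sum_i \sum_j cnorm (A i j).
Proof.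
apply: ge_sup; last by move=> _ [x /= x1 <-]; exact: enorm_mulmx_le.
exists (enorm (A *m 0)), 0 => //=.
apply: le_trans (enorm_le_sum _) _.
by rewrite big1 // => i _; rewrite mxE cnorm0.
Qed.

Lemma cnorm_le_opnorm (n : nat) (A : 'M[CC R]_n) i j : cnorm (A i j) <= opnorm A.
Proof.
have <- : (A *m (delta_mx j 0 : 'cV[CC R]_n)) i 0 = A i j by rewrite -colE mxE.
apply: le_trans (cnorm_le_enorm _ _) _; apply: ub_le_sup.
  by exists (\sum_i \sum_j cnorm (A i j)) => _ [x /= x1 <-]; exact: enorm_mulmx_le.
exists (delta_mx j 0) => //=; apply: le_trans (enorm_le_sum _) _.
rewrite (bigD1 j) //= mxE !eqxx cnorm1 big1 ?addr0 // => k kj.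
by rewrite mxE (negbTE kj) cnorm0.
Qed.

End OperatorNorm.

Section CartanDomain.
Variable R : realType.
Implicit Types z w : C3 R.

Lemma ord3P (P : 'I_3 -> Prop) : P 0 -> P 1 -> P 2%:R -> forall i, P i.
Proof.
move=> P0 P1 P2 [[|[|[|//]]] hi].
- by have -> : Ordinal hi = 0 by exact: val_inj.
- by have -> : Ordinal hi = 1 by exact: val_inj.
- by have -> : Ordinal hi = 2%:R by exact: val_inj.
Qed.

Lemma cartanII_bounded z i : cartanII z -> cnorm (z 0 i) <= 1.
Proof.
rewrite /cartanII /= => /ltW z1; apply: le_trans z1.
move: i; apply: ord3P.
- by have := cnorm_le_opnorm (symmx z) 0 0; rewrite mxE.
- by have := cnorm_le_opnorm (symmx z) 1 1; rewrite mxE.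
- by have := cnorm_le_opnorm (symmx z) 0 1; rewrite mxE.
Qed.

Lemma small_cartanII z : (forall i, cnorm (z 0 i) <= 16^-1) -> cartanII z.
Proof.
move=> h; rewrite /cartanII /=; apply: le_lt_trans (opnorm_le_sum _) _.
rewrite !big_ord_recl !big_ord0 !mxE /= !addr0.
by have := h 0; have := h 1; have := h 2%:R; lra.
Qed.

End CartanDomain.

Section Volume.
Variable R : realType.
Notation mu := (@lebesgue_measure R).

(** The integral of a nonnegative function is a supremum over the simple
    functions below it, and Lebesgue measure extends to an outer measure, so the
    product measure is monotone on arbitrary sets: the volume of a domain can be
    compared with that of boxes without knowing that it is measurable. *)
Lemma product_measure1_le (d : measure_display) (T : measurableType d)
    (m : {measure set T -> \bar R}) (A B : set (T * R)) :
  A `<=` B -> ((m \x mu) A <= (m \x mu) B)%E.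
Proof.
move=> AB; rewrite /product_measure1 !ge0_integralTE; first last.
- by move=> x; exact: measure_ge0.
- by move=> x; exact: measure_ge0.
apply: ereal_sup_le => _ [h hA <-].
exists h => //= x; apply: le_trans (hA x) _; apply: le_mu_ext => y.
by rewrite /xsection /= !inE => /AB.
Qed.

Let box (e : R) : set (R * R * R * R * R * R) :=
  let I := `[- e, e]%classic in I `*` I `*` I `*` I `*` I `*` I.

Let box_measure (e : R) : 0 < e ->
  (mu \x mu \x mu \x mu \x mu \x mu)%E (box e) = ((2 * e) ^+ 6)%:E.
Proof.
move=> e0; rewrite /box.
have mI : measurable `[- e, e]%classic by exact: measurable_itv.
have I1 : mu `[- e, e]%classic = (2 * e)%:E.
  rewrite lebesgue_measure_itv /= lte_fin.
  have -> : - e < e by lra.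
  by rewrite -EFinB; congr (_%:E); ring.
have m2 := measurableX mI mI; have m3 := measurableX m2 mI.
have m4 := measurableX m3 mI; have m5 := measurableX m4 mI.
do 5 rewrite product_measure1E //=.
by rewrite !I1 -!EFinM; congr (_%:E); ring.
Qed.

Let volume_le (A B : set (R * R * R * R * R * R)) : A `<=` B ->
  ((mu \x mu \x mu \x mu \x mu \x mu) A <= (mu \x mu \x mu \x mu \x mu \x mu) B)%E.
Proof. by move=> AB; apply: product_measure1_le. Qed.

Lemma vol_cartanII_gt0 : 0 < vol_cartanII R.
Proof.
rewrite /vol_cartanII; set S := [set p | _].
have lower : box 32^-1 `<=` S.
  move=> [[[[[x1 y1] x2] y2] x3] y3]; rewrite /box /= !in_itv /=.
  move=> [[[[[]]]]]; rewrite -!ler_norml => hx1 hy1 hx2 hy2 hx3 hy3.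
  have h (x y : R) : `|x| <= 32^-1 -> `|y| <= 32^-1 -> cnorm (x +i* y : CC R) <= 16^-1.
    by move=> hx hy; apply: le_trans (cnorm_ReIm _) _ => /=; lra.
  by apply: small_cartanII; apply: ord3P; rewrite mxE /=; exact: h.
have upper : S `<=` box 1.
  move=> [[[[[x1 y1] x2] y2] x3] y3]; rewrite /S /box /= !in_itv /= -!ler_norml.
  have h (x y : R) : cnorm (x +i* y : CC R) <= 1 -> `|x| <= 1 /\ `|y| <= 1.
    by move=> xy; split; [have := Re_cnorm (x +i* y)|have := Im_cnorm (x +i* y)];
      move/le_trans; apply.
  move=> hz.
  have := cartanII_bounded 0 hz; rewrite mxE /= => /h [].
  have := cartanII_bounded 1 hz; rewrite mxE /= => /h [].
  by have := cartanII_bounded 2%:R hz; rewrite mxE /= => /h [].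
apply: fine_gt0; apply/andP; split.
  apply: (lt_le_trans _ (volume_le lower)).
  have e0 : 0 < 32^-1 :> R by rewrite invr_gt0.
  by rewrite box_measure // lte_fin exprn_gt0 // mulr_gt0.
apply: le_lt_trans (volume_le upper) _; rewrite box_measure //.
exact: ltry.
Qed.

End Volume.

(** * Square root identities and the sum of the series *)

Section KernelAlgebra.
Variable R : realType.
Implicit Types a b y : CC R.

(** This is [((a + b) ^ (3/2) - (a - b) ^ (3/2)) / (2 b d ^ (3/2))] for
    [d = a ^ 2 - b ^ 2], written without [b] and hence without a choice of sign. *)
Definition closed_form a d : CC R :=
  (2%:R * a + csqrt d) / (csqrt (2%:R * a + 2%:R * csqrt d) * csqrt d ^+ 3).

Lemma csqrtM a b : 0 < complex.Re a -> 0 < complex.Re b ->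
  0 < complex.Re (a * b) -> csqrt (a * b) = csqrt a * csqrt b.
Proof.
move=> a0 b0 ab0; apply: csqrt_unique => //.
  by apply: Re_mul_gt0; rewrite ?Re_csqrt_gt0 // sqr_csqrt ?Re_gt0_neq0.
by rewrite exprMn !sqr_csqrt ?Re_gt0_neq0.
Qed.

Lemma Re_double_gt0 a b : 0 < complex.Re a -> 0 < complex.Re b ->
  0 < complex.Re (2%:R * a + 2%:R * b).
Proof.
move=> a0 b0; rewrite -mulrDr mulr_natl mulr2n !ReD.
exact: addr_gt0 (addr_gt0 a0 b0) (addr_gt0 a0 b0).
Qed.

Section SumDifference.
Variables a b : CC R.
Hypotheses (a0 : 0 < complex.Re a) (p0 : 0 < complex.Re (a + b))
  (m0 : 0 < complex.Re (a - b)) (d0 : 0 < complex.Re (a ^+ 2 - b ^+ 2)).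

Let u := csqrt (a + b).
Let v := csqrt (a - b).
Let r := csqrt (a ^+ 2 - b ^+ 2).

Let u2 : u ^+ 2 = a + b. Proof. by rewrite sqr_csqrt ?Re_gt0_neq0. Qed.
Let v2 : v ^+ 2 = a - b. Proof. by rewrite sqr_csqrt ?Re_gt0_neq0. Qed.
Let u0 : 0 < complex.Re u. Proof. exact: Re_csqrt_gt0. Qed.
Let v0 : 0 < complex.Re v. Proof. exact: Re_csqrt_gt0. Qed.

Let rE : r = u * v.
Proof.
have E : a ^+ 2 - b ^+ 2 = (a + b) * (a - b) by ring.
by rewrite /r E csqrtM // -E.
Qed.

Let uvE : csqrt (2%:R * a + 2%:R * r) = u + v.
Proof.
have e : (u + v) ^+ 2 = 2%:R * a + 2%:R * r.
  by rewrite rE (_ : 2%:R * a = u ^+ 2 + v ^+ 2); [ring|rewrite u2 v2; ring].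
apply: csqrt_unique => //; first by rewrite ReD addr_gt0.
exact: Re_double_gt0 a0 (Re_csqrt_gt0 d0).
Qed.

Lemma cube_csqrtB : csqrt (a + b) ^+ 3 - csqrt (a - b) ^+ 3 =
  2%:R * b * (2%:R * a + r) / csqrt (2%:R * a + 2%:R * r).
Proof.
have n0 : u + v != 0 by apply: Re_gt0_neq0; rewrite ReD addr_gt0.
rewrite -/u -/v -/r uvE rE.
have -> : 2%:R * b = u ^+ 2 - v ^+ 2 by rewrite u2 v2; ring.
have -> : 2%:R * a = u ^+ 2 + v ^+ 2 by rewrite u2 v2; ring.
by field.
Qed.

Lemma inv_cube_csqrtB : csqrt (a - b) ^- 3 - csqrt (a + b) ^- 3 =
  2%:R * b * closed_form a (a ^+ 2 - b ^+ 2).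
Proof.
have n0 : u + v != 0 by apply: Re_gt0_neq0; rewrite ReD addr_gt0.
have un0 := Re_gt0_neq0 u0; have vn0 := Re_gt0_neq0 v0.
have -> : csqrt (a - b) ^- 3 - csqrt (a + b) ^- 3 =
  (csqrt (a + b) ^+ 3 - csqrt (a - b) ^+ 3) / r ^+ 3.
  by rewrite rE -/u -/v; field; rewrite un0 vn0.
by rewrite cube_csqrtB /closed_form -/r uvE rE; field; rewrite un0 vn0 n0.
Qed.

(** The series is the odd part of the binomial series of
    [(a + b) ^ (3/2) = a ^ (3/2) * (1 + b / a) ^ (3/2)]. *)
Lemma closed_form_series (q : CC R) : b != 0 -> 4%:R * q = b ^+ 2 ->
  cnorm (b / a) <= 16^-1 ->
  (fun N : nat => \sum_(k < N) gbinom (3%:R / 2%:R) (2 * k).+1 *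
     (csqrt a / a ^+ (2 * k) * (4%:R * q) ^+ k / csqrt (a ^+ 2 - b ^+ 2) ^+ 3))
  @ \oo --> closed_form a (a ^+ 2 - b ^+ 2).
Proof.
move=> b0 qb hy; have an0 := Re_gt0_neq0 a0.
pose y := b / a.
have rn0 : r != 0 by exact: csqrt_neq0.
have un0 : csqrt (2%:R * a + 2%:R * r) != 0 by exact: csqrt_neq0.
have half1 (x : CC R) : cnorm x <= 16^-1 -> 0 < complex.Re (1 + x).
  move=> hx; have := @Re_near1 _ (1 + x) 16^-1; rewrite addrAC subrr add0r => /(_ hx); lra.
have hN : cnorm (- y) <= 16^-1 by rewrite cnormN.
have pE : u = csqrt a * csqrt (1 + y).
  rewrite /u -csqrtM ?half1 //; first by congr csqrt; rewrite /y; field.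
  by rewrite (_ : a * (1 + y) = a + b) // /y; field.
have mE : v = csqrt a * csqrt (1 - y).
  rewrite /v -csqrtM ?half1 //; first by congr csqrt; rewrite /y; field.
  by rewrite (_ : a * (1 - y) = a - b) // /y; field.
have lim := odd_binomial_series hy.
pose C : CC R := csqrt a * a / (2%:R * b * r ^+ 3).
have -> : (fun N : nat => \sum_(k < N) gbinom (3%:R / 2%:R) (2 * k).+1 *
     (csqrt a / a ^+ (2 * k) * (4%:R * q) ^+ k / r ^+ 3)) =
   (fun N : nat => C * (2%:R * \sum_(k < N) gbinom (3%:R / 2%:R) (2 * k).+1 * y ^+ (2 * k).+1)).
  apply/funext => N; rewrite !mulr_sumr; apply: eq_bigr => k _.
  rewrite qb -exprM [y ^+ _]exprS /C /y expr_div_n.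
  have := expf_neq0 (2 * k) an0; move: (a ^+ (2 * k)) (b ^+ (2 * k)) => A B A0.
  by field; rewrite rn0 b0 an0 A0.
have -> : closed_form a (a ^+ 2 - b ^+ 2) =
    C * (csqrt (1 + y) ^+ 3 - csqrt (1 - y) ^+ 3).
  have E : a * csqrt a * (csqrt (1 + y) ^+ 3 - csqrt (1 - y) ^+ 3) = u ^+ 3 - v ^+ 3.
    by rewrite pE mE -{1}(sqr_csqrt an0); ring.
  have -> : C * (csqrt (1 + y) ^+ 3 - csqrt (1 - y) ^+ 3) =
     (u ^+ 3 - v ^+ 3) / (2%:R * b * r ^+ 3) by rewrite -E /C; ring.
  by rewrite cube_csqrtB /closed_form -/r; field; rewrite un0 rn0 b0.
exact: cvgMr lim.
Qed.

End SumDifference.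
End KernelAlgebra.

(** * Determinant, holomorphy and the principal branch of the kernel *)

Section Geometry.
Variable R : realType.
Implicit Types z w x : C3 R.

Definition lin_form x w : CC R := 1 - dotmx (sigma x) w.

(** The square of the third coordinate of the preimages of [x] under [phi]. *)
Definition disc x : CC R := x 0 0 * x 0 1 - x 0 2%:R.

Lemma lin_formE x w : lin_form x w =
  1 - x 0 0 * Num.conj (w 0 0) - x 0 1 * Num.conj (w 0 1)
    + x 0 2%:R * Num.conj (w 0 2%:R).
Proof.
rewrite /lin_form dotmxE mxE !big_ord_recl big_ord0 !mxE /=.
have -> : lift ord0 ord0 = 1 :> 'I_3 by exact: val_inj.
have -> : lift ord0 (lift ord0 ord0) = 2%:R :> 'I_3 by exact: val_inj.
by ring.
Qed.

Lemma disc_conj x : Num.conj (disc x) =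
  Num.conj (x 0 0) * Num.conj (x 0 1) - Num.conj (x 0 2%:R).
Proof. by rewrite rmorphB rmorphM. Qed.

Lemma disc_phi z : disc (phi z) = z 0 2%:R ^+ 2.
Proof. by rewrite /disc /phi !mxE /=; ring. Qed.

Lemma det_kernel z w : \det (1%:M - symmx z *m map_mx Num.conj (symmx w)) =
  lin_form (phi z) (phi w) - 2%:R * z 0 2%:R * Num.conj (w 0 2%:R).
Proof.
rewrite lin_formE (expand_det_row _ 0) !big_ord_recl big_ord0 /cofactor.
rewrite !det_mx11 !mxE !big_ord_recl !big_ord0 !mxE /=.
rewrite !rmorphB !rmorphM /=; ring.
Qed.

(** A common bound for the tetrablock and for the image of the Cartan domain
    under [phi], sufficient for all the estimates below. *)
Definition bounded_region x :=
  [/\ cnorm (x 0 0) <= 1, cnorm (x 0 1) <= 1 & cnorm (x 0 2%:R) <= 3].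

(** Beyond these bounds the polynomial defining the tetrablock has an explicit
    zero in the closed bidisc: on one of the axes if a bound on the first two
    coordinates fails, and on the line [b = 1] otherwise. *)
Lemma tetrablock_bounded x : tetrablock x -> bounded_region x.
Proof.
rewrite /tetrablock /= => hx.
have inv_le1 (a : CC R) : 1 < cnorm a -> `|a^-1| <= 1.
  move=> a1; rewrite cnormE cnormV (lecR (cnorm a)^-1 1).
  by rewrite invf_le1 ?ltW //; lra.
have n0 (a : CC R) : 1 < cnorm a -> a != 0.
  by move=> a1; apply/eqP => a0; move: a1; rewrite a0 cnorm0; lra.
have b0 : cnorm (x 0 0) <= 1.
  rewrite leNgt; apply/negP => h.
  have := hx (x 0 0)^-1 0 (inv_le1 _ h); rewrite normr0 ler01 => /(_ isT).
  by rewrite !mulr0 (divff (n0 _ h)) subrr subr0 addr0 eqxx.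
have b1 : cnorm (x 0 1) <= 1.
  rewrite leNgt; apply/negP => h.
  have := hx 0 (x 0 1)^-1; rewrite normr0 ler01 => /(_ isT (inv_le1 _ h)).
  by rewrite !mulr0 mul0r (divff (n0 _ h)) subr0 addr0 subrr eqxx.
split => //; rewrite leNgt; apply/negP => h.
have d2 : 2 < cnorm (x 0 0 - x 0 2%:R).
  have := cnormB (x 0 0) (x 0 0 - x 0 2%:R); rewrite opprB addrC subrK; lra.
have n2 : cnorm (1 - x 0 1) <= 2.
  by apply: le_trans (cnormB _ _) _; rewrite cnorm1; lra.
have d0 : x 0 0 - x 0 2%:R != 0 by apply: n0; lra.
have := hx ((1 - x 0 1) / (x 0 0 - x 0 2%:R)) 1.
rewrite normr1 lexx cnormE cnormM cnormV (lecR _ 1) ler_pdivrMr ?mul1r; last by lra.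
move=> /(_ (le_trans n2 (ltW d2)) isT) /eqP; apply.
by field.
Qed.

Lemma small_tetrablock x : (forall i, cnorm (x 0 i) <= 16^-1) -> tetrablock x.
Proof.
move=> h; rewrite /tetrablock /= => a b; rewrite !cnormE !(lecR _ 1) => a1 b1.
apply/eqP => e.
have : cnorm (x 0 0 * a + x 0 1 * b - x 0 2%:R * a * b) = 1.
  rewrite -cnorm1; congr cnorm; apply/eqP; rewrite eq_sym -subr_eq0 -e; apply/eqP; ring.
have := cnormB (x 0 0 * a + x 0 1 * b) (x 0 2%:R * a * b).
have := cnormD (x 0 0 * a) (x 0 1 * b); rewrite !cnormM.
have le i (c : R) : 0 <= c -> c <= 1 -> cnorm (x 0 i) * c <= 16^-1.
  by move=> c0 c1; rewrite -[leRHS]mulr1 ler_pM ?cnorm_ge0.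
have := le 0 _ (cnorm_ge0 _) a1; have := le 1 _ (cnorm_ge0 _) b1.
have := le 2%:R (cnorm a * cnorm b); rewrite mulr_ge0 ?cnorm_ge0 // mulrA.
have : cnorm a * cnorm b <= 1 by rewrite -[leRHS]mulr1 ler_pM ?cnorm_ge0.
by move=> -> /(_ isT isT); lra.
Qed.

Lemma cartanII_phi_bounded z : cartanII z -> bounded_region (phi z).
Proof.
move=> hz; rewrite /bounded_region /phi !mxE /=.
have h i := cartanII_bounded i hz; split; [exact: h|exact: h|].
apply: le_trans (cnormB _ _) _; rewrite cnormM cnormX.
have : cnorm (z 0 0) * cnorm (z 0 1) <= 1 by rewrite -[leRHS]mulr1 ler_pM ?cnorm_ge0.
have : cnorm (z 0 2%:R) ^+ 2 <= 1 by rewrite exprn_ile1 ?cnorm_ge0.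
lra.
Qed.

(** Pointwise forms of the differentiation rules, to be applied to explicit
    expressions in [y]. *)
Section PointwiseDifferentiable.
Variables (f g : C3 R -> CC R) (x : C3 R).

Lemma differentiable_add : differentiable f x -> differentiable g x ->
  differentiable (fun y => f y + g y) x.
Proof. exact: differentiableD. Qed.

Lemma differentiable_sub : differentiable f x -> differentiable g x ->
  differentiable (fun y => f y - g y) x.
Proof. exact: differentiableB. Qed.

Lemma differentiable_mul : differentiable f x -> differentiable g x ->
  differentiable (fun y => f y * g y) x.
Proof. exact: differentiableM. Qed.

End PointwiseDifferentiable.

Lemma differentiable_const (c : CC R) x : differentiable (fun=> c) x.
Proof. exact: differentiable_cst. Qed.

Lemma differentiable_exp (f : C3 R -> CC R) x n : differentiable f x ->
  differentiable (fun y => f y ^+ n) x.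
Proof.
move=> df; elim: n => [|n IH]; first exact: differentiable_const.
rewrite (_ : (fun y => _) = fun y => f y * f y ^+ n).
  exact: differentiable_mul.
by apply/funext => y; rewrite exprS.
Qed.

(** When [w] is close to [0], the quantities under the square roots of the
    kernel stay close to [1], uniformly in [x]. *)
Section SmallPoint.
Variables (e : R) (w : C3 R).
Hypotheses (e1 : e <= 1000^-1) (hw : forall i, cnorm (w 0 i) <= e).

Let e0 : 0 <= e. Proof. exact: le_trans (cnorm_ge0 _) (hw 0). Qed.

Let cM (a : CC R) i (c : R) : cnorm a <= c -> cnorm (a * Num.conj (w 0 i)) <= c * e.
Proof. by move=> ac; rewrite cnormM cnorm_conj ler_pM ?cnorm_ge0. Qed.

Lemma disc_small : cnorm (disc w) <= 2 * e.
Proof.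
apply: le_trans (cnormB _ _) _; rewrite cnormM.
have w1 : cnorm (w 0 0) <= 1 by have := hw 0; have := e1; lra.
have : cnorm (w 0 0) * cnorm (w 0 1) <= 1 * e by rewrite ler_pM ?cnorm_ge0.
by have := hw 2%:R; lra.
Qed.

Lemma lin_form_near1 x : bounded_region x -> cnorm (lin_form x w - 1) <= 5 * e.
Proof.
move=> [x0 x1 x2]; rewrite lin_formE.
rewrite [X in cnorm X](_ : _ = x 0 2%:R * Num.conj (w 0 2%:R) -
  (x 0 0 * Num.conj (w 0 0) + x 0 1 * Num.conj (w 0 1))); last by ring.
apply: le_trans (cnormB _ _) _.
have := cnormD (x 0 0 * Num.conj (w 0 0)) (x 0 1 * Num.conj (w 0 1)).
by have := cM 0 x0; have := cM 1 x1; have := cM 2%:R x2; lra.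
Qed.

Lemma lin_form_Re_gt0 x : bounded_region x -> 0 < complex.Re (lin_form x w).
Proof. by move=> /lin_form_near1/Re_near1; have := e1; lra. Qed.

Lemma disc_bounded x : bounded_region x -> cnorm (disc x) <= 4.
Proof.
move=> [x0 x1 x2]; apply: le_trans (cnormB _ _) _; rewrite cnormM.
have : cnorm (x 0 0) * cnorm (x 0 1) <= 1 by rewrite -[leRHS]mulr1 ler_pM ?cnorm_ge0.
lra.
Qed.

Lemma discr_Re_gt0 x : bounded_region x ->
  0 < complex.Re (lin_form x w ^+ 2 - 4%:R * disc x * Num.conj (disc w)).
Proof.
move=> hx; set a := lin_form x w.
have ha : cnorm (a - 1) <= 5 * e by exact: lin_form_near1.
suff h : cnorm (a ^+ 2 - 4%:R * disc x * Num.conj (disc w) - 1) <= 1 / 2.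
  by have := Re_near1 h; lra.
rewrite [X in cnorm X](_ : _ = (a - 1) * (a - 1 + 2%:R) - 4%:R * disc x * Num.conj (disc w)); last by ring.
apply: le_trans (cnormB _ _) _; rewrite 3!cnormM cnorm_conj cnorm_nat.
have hD := disc_small; have hD' := disc_bounded hx.
have h2 : cnorm (a - 1 + 2%:R) <= 3.
  by apply: le_trans (cnormD _ _) _; rewrite cnorm_nat; have := e1; lra.
have : cnorm (a - 1) * cnorm (a - 1 + 2%:R) <= 5 * e * 3 by rewrite ler_pM ?cnorm_ge0.
have : 4 * cnorm (disc x) * cnorm (disc w) <= 4 * 4 * (2 * e).
  by rewrite !ler_pM ?mulr_ge0 ?cnorm_ge0.
have := e1; lra.
Qed.

Definition szego_form x : CC R :=
  closed_form (lin_form x w) (lin_form x w ^+ 2 - 4%:R * disc x * Num.conj (disc w)).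

Lemma szego_form_holomorphic : holomorphic_on (@tetrablock R) szego_form.
Proof.
move=> x /tetrablock_bounded hx; rewrite /szego_form /closed_form.
have dc i : differentiable (fun x : C3 R => x 0 i : CC R) x by exact: differentiable_coord.
have dl : differentiable (lin_form ^~ w : C3 R -> CC R) x.
  rewrite (_ : lin_form ^~ w = (fun x : C3 R =>
    1 - x 0 0 * Num.conj (w 0 0) - x 0 1 * Num.conj (w 0 1)
    + x 0 2%:R * Num.conj (w 0 2%:R))); last by apply/funext => y; exact: lin_formE.
  have dm i := differentiable_mul (dc i) (differentiable_const (Num.conj (w 0 i)) x).
  exact: differentiable_add (differentiable_sub
    (differentiable_sub (differentiable_const 1 x) (dm 0)) (dm 1)) (dm 2%:R).
have dd : differentiable (disc : C3 R -> CC R) x.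
  exact: differentiable_sub (differentiable_mul (dc 0) (dc 1)) (dc 2%:R).
pose D x := lin_form x w ^+ 2 - 4%:R * disc x * Num.conj (disc w).
have dD : differentiable (D : C3 R -> CC R) x.
  exact: differentiable_sub (differentiable_exp 2 dl) (differentiable_mul
    (differentiable_mul (differentiable_const _ x) dd) (differentiable_const _ x)).
have D0 : 0 < complex.Re (D x) by exact: discr_Re_gt0.
have dr : differentiable (fun x => csqrt (D x)) x.
  exact: (differentiable_comp dD (csqrt_differentiable D0)).
have d2 (f : C3 R -> CC R) : differentiable f x -> differentiable (fun x : C3 R => 2%:R * f x : CC R) x.
  by move=> df; exact: differentiable_mul (differentiable_const _ x) df.
pose S x := 2%:R * lin_form x w + 2%:R * csqrt (D x).
have dS : differentiable (S : C3 R -> CC R) x.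
  exact: differentiable_add (d2 _ dl) (d2 _ dr).
have S0 : 0 < complex.Re (S x).
  exact: Re_double_gt0 (lin_form_Re_gt0 hx) (Re_csqrt_gt0 D0).
have ds : differentiable (fun x => csqrt (S x)) x.
  exact: (differentiable_comp dS (csqrt_differentiable S0)).
apply: differentiable_mul; first exact: differentiable_add (d2 _ dl) dr.
apply: differentiableV; last by rewrite mulf_neq0 ?expf_neq0 ?csqrt_neq0.
exact: differentiable_mul ds (differentiable_exp 3 dr).
Qed.

End SmallPoint.

(** [principal_branch] applied along the segment from [(z, 0)] to [(z, w)]. *)
Lemma kernel_cartanII_principal (k : C3 R -> C3 R -> CC R) z w :
  kernel_cartanII k -> cartanII z -> (forall i, cnorm (w 0 i) <= 16^-1) ->
  k z w = ((vol_cartanII R)^-1)%:C *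
    csqrt (lin_form (phi z) (phi w) - 2%:R * z 0 2%:R * Num.conj (w 0 2%:R)) ^- 3.
Proof.
move=> [p [[L [cL pL]] p0 kp]] hz hw.
(* the segment from 0 to w, run through by sin t for t between 0 and pi / 2,
   so that the path is defined for all t and never leaves the ball *)
pose W (t : R) : C3 R := (sin t)%:C *: w.
have hW t i : cnorm (W t 0 i) <= 16^-1.
  rewrite mxE cnormM cnorm_real -[leRHS]mul1r.
  by rewrite ler_pM ?cnorm_ge0 ?normr_ge0 ?sin_max.
have cW t : cartanII (W t) by apply: small_cartanII.
pose d t := \det (1%:M - symmx z *m map_mx Num.conj (symmx (W t))).
have cLW : continuous (fun t => L (z, W t)).
  move=> t; have XW s : (@cartanII R `*` @cartanII R) (z, W s) by split; last exact: cW.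
  have cS : (fun s => (sin s)%:C : CC R) @ t --> ((sin t)%:C : CC R).
    exact: cvg_complex (@continuous_sin R t) (cvg_cst 0).
  have cg : (fun s => (z, W s)) @ t --> (z, W t).
    exact: cvg_pair (cvg_cst z) (cvgZr_tmp cS).
  have := (subspace_continuousP _ _).1 cL _ (XW t); apply: cvg_trans => A LA.
  exact: (@filterS _ (nbhs t) _ _ _ (fun s hs => hs (XW s)) (cg _ LA)).
have dE t : d t = cexp (L (z, W t)) by have [] := pL (z, W t) (conj hz (cW t)).
have dRe t : 0 < complex.Re (d t).
  suff h : cnorm (d t - 1) <= 1 / 2 by have := Re_near1 h; lra.
  rewrite /d det_kernel lin_formE; move: (W t) (hW t) => V hV.
  have hz' i := cartanII_bounded i hz.
  rewrite !mxE /= [X in cnorm X](_ : _ =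
    (z 0 0 * z 0 1 - z 0 2%:R ^+ 2) * Num.conj (V 0 0 * V 0 1 - V 0 2%:R ^+ 2)
    - (z 0 0 * Num.conj (V 0 0) + z 0 1 * Num.conj (V 0 1)
       + 2%:R * z 0 2%:R * Num.conj (V 0 2%:R))); last by ring.
  have le2 (a b c c' : R) : 0 <= a -> 0 <= b -> a <= c -> b <= c' -> a * b <= c * c'.
    by move=> *; rewrite ler_pM.
  have zV i : cnorm (z 0 i) * cnorm (V 0 i) <= 1 * 16^-1 by rewrite le2 ?cnorm_ge0.
  have q1 : cnorm (z 0 0 * z 0 1 - z 0 2%:R ^+ 2) <= 2.
    apply: le_trans (cnormB _ _) _; rewrite expr2 !cnormM.
    have := le2 _ _ _ _ (cnorm_ge0 _) (cnorm_ge0 _) (hz' 0) (hz' 1).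
    by have := le2 _ _ _ _ (cnorm_ge0 _) (cnorm_ge0 _) (hz' 2%:R) (hz' 2%:R); lra.
  have q2 : cnorm (V 0 0 * V 0 1 - V 0 2%:R ^+ 2) <= 16^-1.
    apply: le_trans (cnormB _ _) _; rewrite expr2 !cnormM.
    have := le2 _ _ _ _ (cnorm_ge0 _) (cnorm_ge0 _) (hV 0) (hV 1).
    by have := le2 _ _ _ _ (cnorm_ge0 _) (cnorm_ge0 _) (hV 2%:R) (hV 2%:R); lra.
  apply: le_trans (cnormB _ _) _; rewrite cnormM cnorm_conj.
  have := le2 _ _ _ _ (cnorm_ge0 _) (cnorm_ge0 _) q1 q2.
  have := cnormD (z 0 0 * Num.conj (V 0 0) + z 0 1 * Num.conj (V 0 1))
    (2%:R * z 0 2%:R * Num.conj (V 0 2%:R)).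
  have := cnormD (z 0 0 * Num.conj (V 0 0)) (z 0 1 * Num.conj (V 0 1)).
  rewrite !cnormM !cnorm_conj cnorm_nat -mulrA.
  by have := zV 0; have := zV 1; have := zV 2%:R; lra.
have W0 : W 0 = 0 by rewrite /W sin0 scale0r.
have W1 : W (pi / 2) = w by rewrite /W sin_pihalf scale1r.
have pihalf : 0 <= pi / 2 :> R by rewrite divr_ge0 // pi_ge0.
have d0 : d 0 = 1.
  rewrite /d W0 det_kernel lin_formE /phi !mxE /= !conjC0; ring.
have start : cexp (- (3%:R / 2%:R) * L (z, W 0)) = csqrt (d 0) ^- 3.
  have [_ <-] := pL (z, W 0) (conj hz (cW 0)).
  rewrite d0 W0 p0 // (@csqrt_unique _ 1 1) ?expr1n ?invr1 //=.
have := principal_branch pihalf cLW dE dRe start.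
have [_ <-] := pL (z, W (pi / 2)) (conj hz (cW (pi / 2))).
by rewrite /d W1 det_kernel (kp _ _ hz (small_cartanII hw)) => ->.
Qed.

End Geometry.

(** * Orthogonality and the Szegő kernel *)

Section HilbertSpace.
Variables (R : realType) (T : Type) (X : set T) (H : set (T -> CC R))
  (ip : (T -> CC R) -> (T -> CC R) -> CC R).
Hypothesis hilb : hilbert_function_space X H ip.

Lemma ip_linr (a : CC R) f g h : H f -> H g -> H h ->
  ip h (fun x => a * f x + g x) = Num.conj a * ip h f + ip h g.
Proof.
move=> Hf Hg Hh; have Hl := hfs_lin hilb a Hf Hg.
rewrite (hfs_ip_conj hilb Hl Hh) (hfs_ip_lin hilb) // rmorphD rmorphM /=.
by rewrite -(hfs_ip_conj hilb Hf Hh) -(hfs_ip_conj hilb Hg Hh).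
Qed.

(** Cauchy-Schwarz in the degenerate case: [n] has norm zero. *)
Lemma ip_vanishing f n : H f -> H n -> (forall x, X x -> n x = 0) -> ip f n = 0.
Proof.
move=> Hf Hn n0; apply/eqP/negPn/negP => c0.
have nn : ip n n = 0 by apply/(hfs_ip_def hilb).
pose F := ip f f; pose c := ip f n.
have F0 : 0 <= F by exact: hfs_ip_ge0 hilb _ Hf.
have cF : Num.conj F = F by rewrite -(hfs_ip_conj hilb).
have nf : ip n f = Num.conj c by exact: hfs_ip_conj hilb _ _ Hf Hn.
have cc0 : Num.conj c != 0 by rewrite conjC_eq0.
(* along this multiple of n the squared norm of f + l n is - F - 2 *)
pose l := - (F + 1) / Num.conj c.
have cl : Num.conj l = - (F + 1) / c.
  by rewrite rmorphM fmorphV /= conjCK rmorphN rmorphD rmorph1 /= cF.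
have Hl := hfs_lin hilb l Hn Hf.
have := hfs_ip_ge0 hilb Hl.
rewrite (hfs_ip_lin hilb) // !ip_linr // nn nf -/c -/F cl.
rewrite (_ : _ + _ = - (F + 2%:R)); last by rewrite /l; field; rewrite cc0 c0.
have F2 : 0 < F + 2%:R by rewrite ltr_wpDl // ltr0n.
by rewrite oppr_ge0 => /(lt_le_trans F2); rewrite ltxx.
Qed.

(** The form [ip] is a function of representatives; it depends only on their
    restrictions to [X]. *)
Lemma ip_eqr f g h : H f -> H g -> H h -> (forall x, X x -> f x = g x) ->
  ip h f = ip h g.
Proof.
move=> Hf Hg Hh fg; have Hn := hfs_lin hilb (-1) Hg Hf.
have := ip_vanishing Hh Hn; rewrite ip_linr // rmorphN rmorph1 mulN1r addrC.
move=> e; apply/eqP; rewrite -subr_eq0; apply/eqP/e => x Xx.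
by rewrite mulN1r fg // addNr.
Qed.

Lemma ip0r h : H h -> ip h (fun=> 0) = 0.
Proof. by move=> Hh; apply: ip_vanishing => //; exact: hfs_zero hilb. Qed.

End HilbertSpace.

Section SzegoKernel.
Variable R : realType.
Implicit Types z w x : C3 R.

(** The sections of the reproducing kernel of the domain over the two preimages
    of [phi w] differ by a function that is odd in the third coordinate. If it is
    proportional to [Jphi * (F \o phi)], then a suitable multiple of the Szegő
    kernel differs from [F] by a function whose pullback is orthogonal to all
    pullbacks, itself included, and so vanishes. *)
Lemma szego_of_antisymmetric (H : set (C3 R -> CC R)) ip k kE w w' F (al : CC R) :
  hilbert_function_space (@cartanII R) H ip ->
  reproducing_kernel (@cartanII R) H ip k ->
  reproducing_kernel (@tetrablock R)
    [set f | holomorphic_on (@tetrablock R) f /\ H (pullback f)]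
    (fun f g => ip (pullback f) (pullback g)) kE ->
  cartanII w -> cartanII w' -> phi w' = phi w -> w' 0 2%:R = - w 0 2%:R ->
  tetrablock (phi w) -> holomorphic_on (@tetrablock R) F ->
  (forall z, cartanII z -> pullback F z = al * (k z w - k z w')) ->
  forall z, cartanII z -> z 0 2%:R != 0 ->
    F (phi z) = 2%:R * al * Num.conj (Jphi w) * kE (phi z) (phi w).
Proof.
move=> hilb rk rkE cw cw' pw' w2 tw holF eF z cz z2.
have [HK rK] := rk w cw; have [HK' rK'] := rk w' cw'.
have [[holg Hg] rg] := rkE _ tw.
pose g := kE ^~ (phi w).
pose B := fun x => -1 * k x w' + k x w.
have HB : H B by exact: hfs_lin hilb _ _ _ HK' HK.
pose A := fun x => al * B x + (fun=> 0) x.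
have HA : H A by exact: hfs_lin hilb _ _ _ HB (hfs_zero hilb).
have AF x : cartanII x -> A x = pullback F x.
  by move=> cx; rewrite eF // /A /B mulN1r addr0 [- _ + _]addrC.
have HF : H (pullback F) by exact: hfs_sat hilb _ _ HA AF.
pose be := 2%:R * al * Num.conj (Jphi w).
pose h := fun x => - be * g x + F x.
have ph : pullback h = fun x => - be * pullback g x + pullback F x.
  by apply/funext => x; rewrite /pullback /h; ring.
have Hh : H (pullback h) by rewrite ph; exact: hfs_lin hilb _ _ _ Hg HF.
have holh : holomorphic_on (@tetrablock R) h.
  move=> x tx; apply: differentiable_add (holF x tx).
  exact: differentiable_mul (differentiable_const _ x) (holg x tx).
have ehg : ip (pullback h) (pullback g) = h (phi w) by apply: rg; split.
have hw : pullback h w = Jphi w * h (phi w) by [].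
have hw' : pullback h w' = - (Jphi w * h (phi w)).
  by rewrite /pullback pw' /Jphi w2; ring.
have ehF : ip (pullback h) (pullback F) = Num.conj al * (2%:R * (Jphi w * h (phi w))).
  rewrite -(ip_eqr hilb HA HF Hh AF) (ip_linr hilb) // ?(ip0r hilb) //; last exact: hfs_zero hilb.
  rewrite addr0 (ip_linr hilb) // rmorphN rmorph1 rK // rK' // hw' hw; ring.
have h0 : ip (pullback h) (pullback h) = 0.
  rewrite {2}ph (ip_linr hilb) // ehg ehF /be rmorphN !rmorphM /= conjCK rmorph_nat; ring.
have /(hfs_ip_def hilb Hh) := h0; move=> /(_ z cz) /eqP.
rewrite /pullback mulf_eq0 oppr_eq0 mulf_eq0 pnatr_eq0 (negbTE z2) /= => /eqP.
by rewrite /h => /eqP; rewrite addrC mulNr subr_eq0 => /eqP.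
Qed.

(** A preimage of [x] under [phi] when [s] is a square root of [disc x]. *)
Definition phi_lift x (s : CC R) : C3 R := vec3 (x 0 0) (x 0 1) s.

Lemma phi_liftK x s : s ^+ 2 = disc x -> phi (phi_lift x s) = x.
Proof.
move=> sx; apply/rowP; apply: ord3P; rewrite !mxE //=.
by rewrite sx /disc; ring.
Qed.

Lemma phi_lift_small x s : (forall i, cnorm (x 0 i) <= 1000^-1) ->
  s ^+ 2 = disc x -> cnorm s <= 20^-1.
Proof.
move=> hx sx; have := disc_small (lexx _) hx; rewrite -sx cnormX => h.
rewrite leNgt; apply/negP => s1.
have : 20^-1 * 20^-1 < cnorm s * cnorm s by rewrite ltr_pM.
by move: h; rewrite expr2; lra.
Qed.

Lemma phi_lift_le x s : (forall i, cnorm (x 0 i) <= 1000^-1) ->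
  cnorm s <= 20^-1 -> forall i, cnorm (phi_lift x s 0 i) <= 16^-1.
Proof.
move=> hx hs; apply: ord3P; rewrite mxE /=.
- by apply: le_trans (hx 0) _; lra.
- by apply: le_trans (hx 1) _; lra.
- by apply: le_trans hs _; lra.
Qed.

Lemma szego_closed_form (kE : C3 R -> C3 R -> CC R) (x u : C3 R) : szego_tetrablock kE ->
  (forall i, cnorm (x 0 i) <= 1000^-1) -> (forall i, cnorm (u 0 i) <= 1000^-1) ->
  disc x != 0 -> disc u != 0 ->
  kE x u = (1 / (2 * vol_cartanII R))%:C * szego_form u x.
Proof.
move=> [H [ip [[hilb _ [k [kk rk]]] rkE]]] hx hu x0 u0.
pose s := csqrt (disc x); pose v := csqrt (disc u).
have sx : s ^+ 2 = disc x by rewrite sqr_csqrt.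
have vu : v ^+ 2 = disc u by rewrite sqr_csqrt.
have vu' : (- v) ^+ 2 = disc u by rewrite sqrrN.
have sz := phi_lift_le hx (phi_lift_small hx sx).
have sw := phi_lift_le hu (phi_lift_small hu vu).
have sw' := phi_lift_le hu (phi_lift_small hu vu').
pose w := phi_lift u v; pose w' := phi_lift u (- v).
have w2 : w 0 2%:R = v by rewrite mxE.
have w'2 : w' 0 2%:R = - v by rewrite mxE.
have pw : phi w = u by exact: phi_liftK.
have pw' : phi w' = u by exact: phi_liftK.
have v0 : v != 0 by exact: csqrt_neq0.
have cv0 : Num.conj v != 0 by rewrite conjC_eq0.
have hv : cnorm v <= 20^-1 by exact: phi_lift_small hu vu.
have Vol0 := vol_cartanII_gt0 R.
set V := vol_cartanII R in Vol0 *.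
have V0 : V%:C != 0 :> CC R by rewrite (inj_eq (@complexI _)) gt_eqF.
have eV (r : R) : (r^-1)%:C = (r%:C)^-1 :> CC R by exact: fmorphV.
(* makes the pullback of szego_form u equal to al times the difference of the
   kernel sections over the two preimages of u *)
pose al : CC R := - V%:C / (2%:R * Num.conj v).
have pb z : cartanII z -> pullback (szego_form u) z = al * (k z w - k z w').
  move=> hz; rewrite !(kernel_cartanII_principal kk hz) // pw pw' w2 w'2 -/V.
  have hb := cartanII_phi_bounded hz.
  have hz2 : cnorm (z 0 2%:R) <= 1 by exact: cartanII_bounded.
  pose a := lin_form (phi z) u; pose b := 2%:R * z 0 2%:R * Num.conj v.
  have a1 : cnorm (a - 1) <= 5 * 1000^-1 by exact: lin_form_near1.
  have b1 : cnorm b <= 8^-1.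
    rewrite /b 2!cnormM cnorm_conj cnorm_nat.
    have : cnorm (z 0 2%:R) * cnorm v <= 1 * 20^-1 by rewrite ler_pM ?cnorm_ge0.
    by rewrite -mulrA; lra.
  have b2 : b ^+ 2 = 4%:R * disc (phi z) * Num.conj (disc u).
    by rewrite disc_phi -vu rmorphXn /b; ring.
  have Ra : 0 < complex.Re a by have := Re_near1 a1; lra.
  have Rp : 0 < complex.Re (a + b).
    by apply: Re_addr_gt0; lra.
  have Rm : 0 < complex.Re (a - b).
    by apply: Re_addr_gt0; rewrite ?cnormN; lra.
  have RD : 0 < complex.Re (a ^+ 2 - b ^+ 2).
    by rewrite b2; exact: discr_Re_gt0.
  rewrite rmorphN mulrN opprK -/a -/b -mulrBr (inv_cube_csqrtB Ra Rp Rm RD).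
  rewrite /pullback /szego_form -b2 -/a /al eV /Jphi.
  move: (closed_form _ _) => cf; rewrite /b.
  by field; rewrite V0 cv0.
have z2 : phi_lift x s 0 2%:R != 0 by rewrite mxE; exact: csqrt_neq0.
have := szego_of_antisymmetric hilb rk rkE (small_cartanII sw) (small_cartanII sw').
rewrite -/w -/w' pw pw' w2 w'2 => /(_ _ _ erefl erefl) key.
have tu : tetrablock u by apply: small_tetrablock => i; apply: le_trans (hu i) _; lra.
have := key _ _ tu (szego_form_holomorphic (lexx _) hu) pb _ (small_cartanII sz) z2.
rewrite phi_liftK // => ->.
have -> : Num.conj (Jphi w) = - (2%:R * Num.conj v).
  by rewrite /Jphi w2 rmorphN rmorphM /= conjC_nat.
have -> : (1 / (2 * V))%:C = 1 / (2%:R * V%:C) :> CC R.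
  by rewrite div1r eV rmorphM /= rmorph_nat div1r.
rewrite /al.
by field; rewrite V0 cv0.
Qed.

End SzegoKernel.

(** * The neighbourhood *)

Section Neighbourhood.
Variables (R : realType) (e : R).

(** The points with [disc x = 0] form the branch locus of [phi]; away from it
    the third coordinates of the preimages can be divided by. *)
Definition small_points : set (C3 R) :=
  [set x : C3 R | (forall i, cnorm (x 0 i) < e) /\ disc x != 0].

Lemma small_points_open : open small_points.
Proof.
have cc i : continuous (fun x : C3 R => x 0 i : CC R) by exact: coord_continuous.
have cd : continuous (@disc R).
  by move=> x; exact: cvgB (cvgM (cc 0 x) (cc 1 x)) (cc 2%:R x).
pose B : set (CC R) := [set y | cnorm y < e].
have oB : open B.
  rewrite (_ : B = ball (0 : CC R) e%:C); first exact: ball_open.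
  apply/seteqP; split => y; rewrite /B /= -ball_normE /= sub0r normrN cnormE ltcR //.
have oi i : open [set x : C3 R | cnorm (x 0 i) < e].
  by apply: (@open_comp _ _ (fun x : C3 R => x 0 i : CC R) B) => // x _; exact: cc.
have oN : open [set x : C3 R | disc x != 0].
  have oC : open (~` [set (0 : CC R)]).
    by apply/closed_openC/accessible_closed_set1/hausdorff_accessible; exact: norm_hausdorff.
  rewrite (_ : [set x | _] = @disc R @^-1` (~` [set 0])).
    by apply: open_comp => // x _; exact: cd.
  by apply/seteqP; split => x /=; [move/eqP|move=> h; apply/eqP].
rewrite (_ : small_points = ([set x : C3 R | cnorm (x 0 0) < e] `&`
  [set x : C3 R | cnorm (x 0 1) < e] `&` [set x : C3 R | cnorm (x 0 2%:R) < e]) `&`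
  [set x : C3 R | disc x != 0]); first by do 3 apply: openI => //.
apply/seteqP; split => x /=; first by move=> [h x0]; split => //; split => //; split.
by move=> [[[h0 h1] h2] x0]; split => //; exact: ord3P.
Qed.

Lemma small_points_nonempty : 0 < e -> small_points !=set0.
Proof.
move=> e0; pose r : R := e / 2; have r0 : 0 < r by rewrite divr_gt0.
have re : r < e by rewrite /r; lra.
exists (vec3 0 0 (r%:C)); clearbody r; split.
  apply: ord3P; rewrite mxE.
  - by rewrite -[X in cnorm X]/(0 : CC R) cnorm0.
  - by rewrite -[X in cnorm X]/(0 : CC R) cnorm0.
  - by rewrite -[X in cnorm X]/(r%:C : CC R) cnorm_real gtr0_norm.
rewrite /disc !mxE /= mul0r sub0r oppr_eq0.
exact: Re_gt0_neq0.
Qed.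

End Neighbourhood.

Theorem mainTheorem3 (R : realType) (kE : C3 R -> C3 R -> CC R)
    (hkE : szego_tetrablock kE) :
  exists (W : set (C3 R)) (c : R),
  [/\ open W, W !=set0, W `<=` @tetrablock R, 0 < c &
      forall z w : C3 R, W z -> W w ->
      let a := 1 - dotmx (sigma z) w in
      let q := z 0 0 * z 0 1 - z 0 2%:R in
      let q' := Num.conj (w 0 0) * Num.conj (w 0 1) - Num.conj (w 0 2%:R) in
      let D := a ^+ 2 - 4%:R * q * q' in
      let t := fun k : nat =>
        gbinom (3%:R / 2%:R) (2 * k).+1 *
        (cpow a (3%:R / 2%:R - (2 * k)%:R - 1) * 4%:R ^+ k * q ^+ k * q' ^+ k /
           cpow D (3%:R / 2%:R)) in
      [/\ slit_plane a, slit_plane D, cvgn (series t) &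
          kE z w = c%:C * limn (series t)]].
Proof.
exists (@small_points R 1000^-1), (1 / (2 * vol_cartanII R)); split.
- exact: small_points_open.
- by apply: small_points_nonempty; rewrite invr_gt0 ltr0n.
- move=> x [hx _]; apply: small_tetrablock => i; apply: le_trans (ltW (hx i)) _; lra.
- by rewrite divr_gt0 // mulr_gt0 // vol_cartanII_gt0.
move=> z w [hz z0] [hw w0] a q q' D t.
have {}hz i : cnorm (z 0 i) <= 1000^-1 by exact/ltW/hz.
have {}hw i : cnorm (w 0 i) <= 1000^-1 by exact/ltW/hw.
have tz : tetrablock z by apply: small_tetrablock => i; apply: le_trans (hz i) _; lra.
have bz := tetrablock_bounded tz.
have q'E : q' = Num.conj (disc w) by rewrite disc_conj.
have Ra : 0 < complex.Re a by exact: (lin_form_Re_gt0 (lexx _) hw bz).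
have RD : 0 < complex.Re D by rewrite /D q'E; exact: (discr_Re_gt0 (lexx _) hw bz).
(* the third coordinates of preimages of z and w under phi *)
pose s := csqrt q; pose v := csqrt (disc w).
have s2 : s ^+ 2 = q by rewrite sqr_csqrt.
have v2 : v ^+ 2 = disc w by rewrite sqr_csqrt.
have hs : cnorm s <= 20^-1 by exact: (phi_lift_small hz s2).
have hv : cnorm v <= 20^-1 by exact: (phi_lift_small hw v2).
pose b := 2%:R * s * Num.conj v.
have b2 : 4%:R * (q * q') = b ^+ 2 by rewrite q'E -v2 -s2 rmorphXn /b; ring.
have DE : D = a ^+ 2 - b ^+ 2 by rewrite -b2 mulrA.
have b0 : b != 0.
  apply: mulf_neq0; last by rewrite conjC_eq0 csqrt_neq0.
  by apply: mulf_neq0; [rewrite pnatr_eq0|exact: csqrt_neq0].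
have a1 : cnorm (a - 1) <= 5 * 1000^-1 by exact: (lin_form_near1 hw bz).
have hb : cnorm b <= 200^-1.
  rewrite /b 2!cnormM cnorm_conj cnorm_nat -mulrA.
  have : cnorm s * cnorm v <= 20^-1 * 20^-1 by rewrite ler_pM ?cnorm_ge0.
  lra.
have aR : 2^-1 <= cnorm a.
  apply: le_trans (le_trans (ler_norm _) (Re_cnorm a)).
  by have := Re_near1 a1; lra.
have hy : cnorm (b / a) <= 16^-1.
  by rewrite cnormM cnormV ler_pdivrMr; lra.
have Rp : 0 < complex.Re (a + b).
  by apply: Re_addr_gt0; lra.
have Rm : 0 < complex.Re (a - b).
  by apply: Re_addr_gt0; rewrite ?cnormN; lra.
have RD' : 0 < complex.Re (a ^+ 2 - b ^+ 2) by rewrite -DE.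
have lim : series t @ \oo --> closed_form a D.
  rewrite [series t](_ : _ = fun N : nat => \sum_(k < N)
      gbinom (3%:R / 2%:R) (2 * k).+1 * (csqrt a / a ^+ (2 * k) *
      (4%:R * (q * q')) ^+ k / csqrt (a ^+ 2 - b ^+ 2) ^+ 3)).
    by rewrite DE; exact: closed_form_series.
  apply/funext => N; rewrite /series /= big_mkord; apply: eq_bigr => k _.
  rewrite /t cpow_half_even ?Re_gt0_neq0 // cpow_3half -DE.
  by rewrite !exprMn !mulrA.
split.
- exact: slit_plane_Re_gt0.
- exact: slit_plane_Re_gt0.
- by apply/cvg_ex; exists (closed_form a D).
- rewrite (cvg_lim (@norm_hausdorff _ _) lim) (szego_closed_form hkE hz hw z0 w0).
  by rewrite /szego_form /D q'E.
Qed.
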